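(* Let $(X,\mathcal{B},m,T)$ be an invertible, conservative, ergodic, measure preserving system on a standard $\sigma$-finite measure space with $m(X)=\infty$. Let $0\le f\in L_1(X,m)$ and let $(a_n)_{n\ge 1}$ be a sequence of real numbers with $a_n\to\infty$. If $$0<\liminf_{n\to\infty}\frac{\Sigma_n(f)(x)}{a_n}<\infty\quad\text{for } m\text{-a.e. } x,$$ then, for $m$-a.e. $x$, $$\frac{\liminf_{n\to\infty}\frac{\Sigma_n(f)(x)}{a_n}}{\limsup_{n\to\infty}\frac{\Sigma_n(f)(x)}{a_n}}\le\frac{10001}{10002}.$$
   Context: For an invertible measure preserving transformation $T$ and a function $f$, the symmetric (two-sided) Birkhoff sums are $\Sigma_n(f)(x):=\sum_{|k|<n}f(T^kx)$, the sum being over integers $k$. For $0\le f\in L_1(X,m)$ and $a_n\to\infty$ the functions $\liminf_{n}\Sigma_n(f)/a_n$ and $\limsup_n\Sigma_n(f)/a_n$ are $T$-invariant, hence a.e. constant (possibly $\infty$). Convention: $\frac{a}{\infty}=0$ for all $0\le a<\infty$. *)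

(* Defs.v *)
From HB Require Import structures.
From mathcomp Require Export all_boot all_order all_algebra.
From mathcomp Require Export all_classical all_reals all_analysis.
Export Order.TTheory GRing.Theory Num.Theory.
Export numFieldNormedType.Exports.

Set Implicit Arguments.
Unset Strict Implicit.
Unset Printing Implicit Defensive.

Local Open Scope classical_set_scope.
Local Open Scope ring_scope.

(* X is isomorphic, as a measurable space, to a Polish space with its Borel
   sets. A Hausdorff complete pseudometric space is a complete metric space
   up to the choice of metric; for such spaces separability is second
   countability. *)
Definition standard_borel (R : realType) (d : measure_display)
    (X : measurableType d) : Prop :=
  exists (Y : completePseudoMetricType R) (phi : X -> Y),
    [/\ hausdorff_space Y, @second_countable Y, bijective phi
      & forall B : set Y, <<s [set U : set Y | open U] >> B <->
                          measurable (phi @^-1` B)].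

Section dynamics.
Context {d : measure_display} {X : measurableType d} {R : realType}.
Variables (m : {measure set X -> \bar R}) (T : X -> X).

Definition measure_preserving : Prop :=
  measurable_fun setT T /\
  forall A : set X, measurable A -> m (T @^-1` A) = m A.

(* W with pairwise disjoint preimages T^-n W, n >= 0, is a wandering set. *)
Definition wandering (W : set X) : Prop :=
  measurable W /\ trivIset setT (fun n : nat => iter n T @^-1` W).

Definition conservative : Prop :=
  forall W : set X, wandering W -> m W = 0%E.

Definition ergodic : Prop :=
  forall A : set X, measurable A -> T @^-1` A = A ->
    m A = 0%E \/ m (~` A) = 0%E.

End dynamics.

(* T^k for k : int, where S is the inverse of T (Negz n stands for - n.+1). *)
Definition iterz {X : Type} (T S : X -> X) (k : int) : X -> X :=
  match k with
  | Posz n => iter n T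
  | Negz n => iter n.+1 S
  end.

Definition birkhoff_sym {X : Type} {R : realType} (T S : X -> X) (f : X -> R)
    (n : nat) (x : X) : R :=
  \sum_(k \in [set k : int | `|k| < n%:Z]) f (iterz T S k x).

(* The ratio is a total division in R; its value at the finitely many n with
   a n = 0 does not affect the lower and upper limits below. *)
Definition birkhoff_liminf {X : Type} {R : realType} (T S : X -> X)
    (f : X -> R) (a : nat -> R) (x : X) : \bar R :=
  limn_einf (fun n => (birkhoff_sym T S f n x / a n)%:E).

Definition birkhoff_limsup {X : Type} {R : realType} (T S : X -> X)
    (f : X -> R) (a : nat -> R) (x : X) : \bar R :=
  limn_esup (fun n => (birkhoff_sym T S f n x / a n)%:E).

(* Main.v *)
Require Import Defs.
From HB Require Import structures.
From mathcomp Require Import measurable_realfun zify ring lra.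

Set Implicit Arguments.
Unset Strict Implicit.
Unset Printing Implicit Defensive.

Local Open Scope classical_set_scope.
Local Open Scope ring_scope.

(** Let Sigma_n be the symmetric sums of f, with f >= 0 without loss of
generality. If the ratio exceeds 10001/10002 on a non-null set, then for some
rational q > 0 and A n := q * a n the inequalities
    A n <= Sigma_n(x) <= 11/10 * A n    for n large enough
hold on a non-null set of points x. That set is invariant, hence conull,
provided that Sigma_(n+1) / Sigma_n --> 1 almost everywhere
([measure_slowC]); this last fact follows from the maximal ergodic inequality
([maximal_inequality]), which lets one truncate f at a high level.
The contradiction ([no_homogeneous_balls]) is then obtained in two steps.

On one orbit. Regard the values f (T^k x) as a mass on the integers. At all
positions of a set B carrying nearly all the mass, balls of the same radius
have nearly the same mass. Such a mass has no gap ([no_gap]). Suppose that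
e and e + L are the ends of a long interval with little mass inside. Seen from
e, a ball of radius at most L only has a left half, which therefore already
carries the mass A L. A ball around a point e - u with u > 0 in B sees the mass
to the left of e from its middle. Comparing with the balls around e, the mass
within distance 2 u of e is nearly the mass within distance u, as long as
u < L; comparing balls of radius L + u, those around e see the points just
after e + L and those around e - u do not, so that A u is negligible. Between
the last u for which this comparison is available and the next point of B
there is no room for the mass A L.

On the whole space. Let D be a set of finite measure of points where the first
step applies, and let the age of a point be the time since its last visit to
D. Since m is infinite, for every t most of the points of age less than a
large s have age more than t ([visited_within_unbounded]). The absence of gaps
says that the mass met between the ages k / 3 and k is at least of the order
of k * (A s / s). Averaged over all points of age between t and s, this
forces the f-mass of the points of age at least t / 3 to be at least of the
order of (A s / s) times the measure of the points of age less than s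
([gap_transport], [log_window]). That last product is bounded below, because
every point of D is met within s steps by s points and a ball of radius s has
mass at most of the order of A s ([weighted_visited_within]). But the f-mass
of the points of large age tends to 0, as f is integrable. *)

(** * Nearly homogeneous masses on the integers *)

(** [V] is the cumulative function of a mass on the integers, so that
[V j - V i] is the mass of the interval [i, j), and [C] the cumulative function
of its part outside [B], which [fwd] and [bwd] make negligible on every interval
that starts or ends at the origin. *)
Section homogeneous.
Variables (R : realFieldType) (V C : int -> R) (B : pred int).
Variables (A : nat -> R) (N : nat).
Hypothesis V_mono : {homo V : i j / i <= j}.
Hypothesis C_mono : {homo C : i j / i <= j}.
Hypothesis CV : forall i j, i <= j -> C j - C i <= V j - V i.
Hypothesis free : forall i j, i <= j ->
  (forall k, i <= k < j -> ~~ B k) -> V j - V i <= C j - C i.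
Hypothesis N_gt0 : (0 < N)%N.
Hypothesis ball_ge : forall c (r : nat), B c -> (N <= r)%N ->
  A r <= V (c + r%:Z) - V (c - r%:Z + 1).
Hypothesis ball_le : forall c (r : nat), B c -> (N <= r)%N ->
  V (c + r%:Z) - V (c - r%:Z + 1) <= 11%:R / 10%:R * A r.
Hypothesis B0 : B 0.
Hypothesis fwd : forall n : nat, C n%:Z - C 0 <= 100%:R^-1 * (V n%:Z - V 0).
Hypothesis bwd : forall n : nat,
  C 1 - C (1 - n%:Z) <= 100%:R^-1 * (V 1 - V (1 - n%:Z)).

(* [lia] is much slower in the presence of the hypotheses cleared here. *)
Ltac position := repeat match goal with
  | H : context [V] |- _ => clear H | H : context [C] |- _ => clear H
  | H : context [A] |- _ => clear H | H : context [B] |- _ => clear H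
  | H : ?T |- _ => unify T (Num.RealField.sort R); clear H
  end; lia.

Lemma scale_mono (r s : nat) : (N <= r)%N -> (r <= s)%N ->
  A r <= 11%:R / 10%:R * A s.
Proof.
move=> Nr rs; have Ns := leq_trans Nr rs.
have := ball_ge B0 Nr; have := ball_le B0 Ns; rewrite !add0r.
have : V r%:Z <= V s%:Z by apply: V_mono; position.
have : V (- s%:Z + 1) <= V (- r%:Z + 1) by apply: V_mono; position.
lra.
Qed.

(** An interval of length [k] that meets [B] lies in the ball of radius [k]
around a point of [B]. *)
Lemma good_mass_short (i : int) (k : nat) : (N <= k)%N ->
  (V (i + k%:Z) - C (i + k%:Z)) - (V i - C i) <= 11%:R / 10%:R * A k.
Proof.
move=> Nk.
have [/existsP[j Bj]|none] := boolP [exists j : 'I_k, B (i + (j : nat)%:Z)].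
  have := ball_le Bj Nk; have jk := ltn_ord j.
  have : V (i + k%:Z) <= V (i + (j : nat)%:Z + k%:Z) by apply: V_mono; position.
  have : V (i + (j : nat)%:Z - k%:Z + 1) <= V i by apply: V_mono; position.
  have : C i <= C (i + k%:Z) by apply: C_mono; position.
  lra.
have := @free i (i + k%:Z); have -> : i <= i + k%:Z by position.
move=> /(_ isT) /= H.
have {H} : V (i + k%:Z) - V i <= C (i + k%:Z) - C i.
  apply: H => l lik; apply/negP => Bl; case/negP: none; apply/existsP.
  have lk : (`|l - i| < k)%N by position.
  exists (Ordinal lk) => /=; suff -> : i + `|l - i|%N = l by [].
  lia.
have := ball_le B0 Nk; rewrite !add0r.
have : V (- k%:Z + 1) <= V k%:Z by apply: V_mono; position.
lra.
Qed.

Lemma good_mass_long (i : int) (k q : nat) : (N <= k)%N ->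
  (V (i + (q * k)%:Z) - C (i + (q * k)%:Z)) - (V i - C i)
    <= q%:R * (11%:R / 10%:R * A k).
Proof.
move=> Nk; elim: q => [|q IH]; first by rewrite mul0n addr0 mul0r; lra.
have := good_mass_short (i + (q * k)%:Z) Nk.
have -> : i + (q * k)%:Z + k%:Z = i + (q.+1 * k)%:Z by position.
rewrite -natr1; move: IH; set a := A k.
rewrite mulrDl mul1r; lra.
Qed.

(** A ball of radius [s] is covered by about [2 * s / k] intervals of length
[k], and almost all its mass is in [B]. *)
Lemma scale_regular (k s : nat) : (N <= k)%N -> (k <= s)%N ->
  k%:R * A s <= 4%:R * s%:R * A k.
Proof.
move=> Nk ks; have Ns := leq_trans Nk ks.
have k0 : (0 < k)%N by position.
have C01 : C 0 <= C 1 by apply: C_mono.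
have V1s : V 1 <= V s%:Z by apply: V_mono; position.
have V0s : V (1 - s%:Z) <= V 0 by apply: V_mono; position.
have As : A s <= V s%:Z - V (1 - s%:Z).
  by have := ball_ge B0 Ns; rewrite !add0r; have -> : 1 - s%:Z = - s%:Z + 1 by position.
have Ak0 : 0 <= A k.
  have := ball_le B0 Nk; rewrite !add0r.
  have : V (- k%:Z + 1) <= V k%:Z by apply: V_mono; position.
  lra.
have [q qk qk3] : exists2 q : nat, (2 * s <= q * k)%N & (q * k <= 3 * s)%N.
  have h1 := divn_eq (2 * s) k; have h2 := ltn_pmod (2 * s) k0.
  exists ((2 * s) %/ k).+1; rewrite mulSn;
    move: ((2 * s) %/ k * k)%N ((2 * s) %% k)%N h1 h2 => ? ?; lia.
have le1 : V s%:Z - C s%:Z <=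
    V (1 - s%:Z + (q * k)%:Z) - C (1 - s%:Z + (q * k)%:Z).
  have sq : s%:Z <= 1 - s%:Z + (q * k)%:Z by move: (q * k)%N qk {qk3} => ? ?; lia.
  by have := CV sq; lra.
have M := good_mass_long (1 - s%:Z) q Nk.
have f1 := fwd s; have b1 := bwd s.
have {M} M2 : A s * (98%:R / 100%:R) <= q%:R * (11%:R / 10%:R * A k) by lra.
have kR : 0 < k%:R :> R by rewrite ltr0n.
have qkR : q%:R * k%:R <= 3%:R * s%:R :> R by rewrite -!natrM ler_nat.
have h1 : k%:R * (A s * (98%:R / 100%:R)) <= k%:R * (q%:R * (11%:R / 10%:R * A k)).
  by rewrite ler_pM2l.
have h2 : q%:R * k%:R * A k <= 3%:R * s%:R * A k by rewrite ler_wpM2r.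
have h3 : 0 <= s%:R * A k by rewrite mulr_ge0.
lra.
Qed.

Hypothesis recur : forall k : nat, exists2 j, (k <= j)%N & B j%:Z.

(** If the interval (p, 3p] had little mass, let [e] and [e + L] be the points
of [B] around it. The mass of the window of length [L] ending at [e] is about
[H := A L], as the right half of the ball of radius [L] around [e] is nearly
empty. Write [u] and [u1] for the consecutive distances from [e] of points of
[B] such that [2 * u <= v < 2 * u1], where [v] is the largest such distance
below [L]. The ball around [e - u1] reaching [e] also reaches beyond
[e - v], hence carries nearly all the mass, and so does the interval between
[e - u] and [e], because balls of equal radii around [e - u1] and [e] have
comparable masses. On the other hand this interval has a mass at most of the order of
[A u], and [A u] is small: the ball of radius [L + u] around [e] contains
the [u] positions after [e + L], the one around [e - u] does not, and both
contain nearly the same mass to the left of [e]. *)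
Lemma no_gap (p : nat) : (N <= p.+1)%N -> 100%:R * A N <= A p.+1 ->
  A p.+1 <= 100%:R * (V (3 * p + 1)%:Z - V (p + 1)%:Z).
Proof.
move=> Np Abig; rewrite leNgt; apply/negP => gap.
have AN0 : 0 <= A N.
  have := ball_le B0 (leqnn N); rewrite !add0r.
  have : V (- N%:Z + 1) <= V N%:Z by apply: V_mono; position.
  lra.
have [e /andP[ep Be] e_last] : exists2 e : nat, (e <= p)%N && B e%:Z &
    forall k : nat, (k <= p)%N && B k%:Z -> (k <= e)%N.
  have ex : exists k : nat, (k <= p)%N && B k%:Z by exists 0%N.
  have bd (k : nat) : (k <= p)%N && B k%:Z -> (k <= p)%N by case/andP.
  by case: (ex_maxnP ex bd) => e; exists e.
have [e' /andP[e'p Be'] e'_first] : exists2 e' : nat, (3 * p + 1 <= e')%N && B e'%:Z &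
    forall k : nat, (3 * p + 1 <= k)%N && B k%:Z -> (e' <= k)%N.
  have ex : exists k : nat, (3 * p + 1 <= k)%N && B k%:Z.
    by have [j j1 j2] := recur (3 * p + 1); exists j; rewrite j1.
  by case: (ex_minnP ex) => e'; exists e'.
have [L e'L] : exists L, e' = (e + L)%N by exists (e' - e)%N; position.
have pL : (p.+1 <= L)%N by position.
have NL : (N <= L)%N by position.
set H := A L.
have ApH : A p.+1 <= 11%:R / 10%:R * H by apply: scale_mono.
have e'E : e'%:Z = e%:Z + L%:Z by position.
rewrite e'E in Be'.
pose g := V (e%:Z + L%:Z) - V (e%:Z + 1).
have g_small : g <= H / 40%:R.
  have h1 : V (p + 1)%:Z - V (e%:Z + 1) <= C (p + 1)%:Z - C (e%:Z + 1).
    apply: free => [|k k1]; first by position.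
    apply/negP => Bk; have := e_last `|k|%N.
    have kE : k = `|k|%N :> int by position.
    by rewrite -kE Bk andbT; position.
  have h2 : V (e%:Z + L%:Z) - V (3 * p + 1)%:Z <= C (e%:Z + L%:Z) - C (3 * p + 1)%:Z.
    apply: free => [|k k1]; first by position.
    apply/negP => Bk; have := e'_first `|k|%N.
    have kE : k = `|k|%N :> int by position.
    by rewrite -kE Bk andbT; position.
  have h3 : C (p + 1)%:Z <= C (3 * p + 1)%:Z by apply: C_mono; position.
  have h4 : C 0 <= C (e%:Z + 1) by apply: C_mono; position.
  have := fwd e'; rewrite e'E => h5.
  have := ball_le B0 Np; rewrite !add0r => h6.
  have h7 : V (e%:Z + 1) <= V p.+1%:Z by apply: V_mono; position.
  have h8 : V (- p.+1%:Z + 1) <= V 0 by apply: V_mono; position.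
  rewrite /g; lra.
have g_ge0 : 0 <= g by rewrite /g subr_ge0; apply: V_mono; position.
have ball0L := ball_le B0 NL; rewrite !add0r -/H in ball0L.
have H0 : 0 <= H.
  have : V (- L%:Z + 1) <= V L%:Z by apply: V_mono; position.
  lra.
have HN : 90%:R * A N <= H by lra.
pose w := C (e%:Z + 1) - C (e%:Z + 1 - L%:Z).
have w_small : w <= H / 40%:R.
  have h1 := fwd (e + 1); have h2 := bwd (L - e).
  have h3 : C 0 <= C 1 by apply: C_mono.
  have h4 : V (e + 1)%:Z <= V L%:Z by apply: V_mono; position.
  have h5 : V (- L%:Z + 1) <= V 0 by apply: V_mono; position.
  have h6 : V 1 <= V L%:Z by apply: V_mono; position.
  have h7 : V (- L%:Z + 1) <= V (1 - (L - e)%:Z) by apply: V_mono; position.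
  have -> : w = C (e + 1)%:Z - C (1 - (L - e)%:Z).
    by rewrite /w; congr (C _ - C _); position.
  lra.
have single (j : int) : B j -> V (j + 1) - V j <= H / 80%:R.
  move=> Bj; have := ball_le Bj (leqnn N).
  have : V (j + 1) <= V (j + N%:Z) by apply: V_mono; position.
  have : V (j - N%:Z + 1) <= V j by apply: V_mono; position.
  lra.
have lL : H - g <= V (e%:Z + 1) - V (e%:Z - L%:Z + 1).
  by have := ball_ge Be NL; rewrite /g /H; lra.
have [v /andP[vL Bv] v_last] : exists2 v : nat, (v < L)%N && B (e%:Z - v%:Z) &
    forall k : nat, (k < L)%N && B (e%:Z - k%:Z) -> (k <= v)%N.
  have ex : exists k : nat, (k < L)%N && B (e%:Z - k%:Z).
    by exists 0%N; rewrite subr0 Be andbT; position.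
  have bd (k : nat) : (k < L)%N && B (e%:Z - k%:Z) -> (k <= L)%N.
    by case/andP => /ltnW.
  by case: (ex_maxnP ex bd) => v; exists v.
have v_mass : H - g - w <= V (e%:Z + 1) - V (e%:Z - v%:Z).
  have h1 : V (e%:Z - v%:Z) - V (e%:Z - L%:Z + 1) <= C (e%:Z - v%:Z) - C (e%:Z - L%:Z + 1).
    apply: free => [|k k1]; first by position.
    apply/negP => Bk.
    have [k' k'E] : exists k' : nat, e%:Z - k'%:Z = k.
      by exists `|e%:Z - k|%N; position.
    by have := v_last k'; rewrite k'E Bk andbT; position.
  have h2 : C (e%:Z - v%:Z) <= C (e%:Z + 1) by apply: C_mono; position.
  have wE : w = C (e%:Z + 1) - C (e%:Z - L%:Z + 1) by rewrite /w; congr (_ - C _); position.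
  lra.
have Apos : 0 < H.
  rewrite lt_def H0 andbT; apply/eqP => HE.
  have := scale_mono (leqnn N) NL; rewrite -/H HE => ?.
  have h1 : V (3 * p + 1)%:Z - V (p + 1)%:Z >= 0 by rewrite subr_ge0; apply: V_mono; position.
  lra.
have v_gt0 : (0 < v)%N.
  rewrite lt0n; apply/eqP => v0; move: v_mass; rewrite v0 subr0.
  by have := single _ Be; lra.
have [u1 /andP[u1v Bu1] u1_first] : exists2 u1 : nat,
    (v < 2 * u1)%N && B (e%:Z - u1%:Z) &
    forall k : nat, (v < 2 * k)%N && B (e%:Z - k%:Z) -> (u1 <= k)%N.
  have ex : exists k : nat, (v < 2 * k)%N && B (e%:Z - k%:Z).
    by exists v; rewrite Bv andbT; position.
  by case: (ex_minnP ex) => u1; exists u1.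
have u1_le : (u1 <= v)%N by apply: u1_first; rewrite Bv andbT; position.
have [u /andP[uv Bu] u_last] : exists2 u : nat, (2 * u <= v)%N && B (e%:Z - u%:Z) &
    forall k : nat, (2 * k <= v)%N && B (e%:Z - k%:Z) -> (k <= u)%N.
  have ex : exists k : nat, (2 * k <= v)%N && B (e%:Z - k%:Z).
    by exists 0%N; rewrite subr0 Be andbT.
  have bd (k : nat) : (2 * k <= v)%N && B (e%:Z - k%:Z) -> (k <= v)%N.
    by case/andP => + _; position.
  by case: (ex_maxnP ex bd) => u; exists u.
have between : V (e%:Z - u%:Z) - V (e%:Z - u1%:Z + 1) <= w.
  have h1 : V (e%:Z - u%:Z) - V (e%:Z - u1%:Z + 1) <= C (e%:Z - u%:Z) - C (e%:Z - u1%:Z + 1).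
    apply: free => [|k k1]; first by position.
    apply/negP => Bk.
    have [k' k'E] : exists k' : nat, e%:Z - k'%:Z = k.
      by exists `|e%:Z - k|%N; position.
    have := u_last k'; have := u1_first k'; rewrite k'E Bk !andbT; position.
  have h2 : C (e%:Z - u%:Z) <= C (e%:Z + 1) by apply: C_mono; position.
  have h3 : C (e%:Z + 1 - L%:Z) <= C (e%:Z - u1%:Z + 1) by apply: C_mono; position.
  rewrite /w; lra.
have lu1 : V (e%:Z + 1) - V (e%:Z - u1%:Z) <=
    V (e%:Z + 1) - V (e%:Z - u%:Z) + w + H / 80%:R.
  by have := single _ Bu1; lra.
(* the ball around e - u1 reaches from e beyond e - v *)
have many : H * (3%:R / 4%:R) <= V (e%:Z + 1) - V (e%:Z - u%:Z).
  have [Nu1|u1N] := leqP N u1.+1.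
    have h1 := ball_le Bu1 Nu1; have h2 := ball_ge Bu1 Nu1.
    have h3 : V (e%:Z - u1%:Z + u1.+1%:Z) = V (e%:Z + 1) by congr V; position.
    have h4 : V (e%:Z - u1%:Z - u1.+1%:Z + 1) <= V (e%:Z - v%:Z) by apply: V_mono; position.
    have h5 := ball_ge Be Nu1.
    have h6 : V (e%:Z + u1.+1%:Z) <= V (e%:Z + L%:Z) by apply: V_mono; position.
    have h7 : V (e%:Z - u1.+1%:Z + 1) = V (e%:Z - u1%:Z) by congr V; position.
    rewrite h3 in h1 h2; rewrite h7 in h5; rewrite /g in g_small v_mass; lra.
  have h1 := ball_le Bu1 (leqnn N).
  have h3 : V (e%:Z + 1) <= V (e%:Z - u1%:Z + N%:Z) by apply: V_mono; position.
  have h4 : V (e%:Z - u1%:Z - N%:Z + 1) <= V (e%:Z - v%:Z) by apply: V_mono; position.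
  lra.
(* the ball of radius L + u around e - u misses e + L and what follows *)
have rho : V (e%:Z + L%:Z + u%:Z) - V (e%:Z + L%:Z) <= H * (3%:R / 10%:R).
  have NLu : (N <= L + u)%N by position.
  have h1 := ball_ge Bu NLu; have h2 := ball_le Be NLu; have h3 := ball_le Bv NL.
  have h4 : V (e%:Z - u%:Z + (L + u)%:Z) = V (e%:Z + L%:Z) by congr V; position.
  have h5 : V (e%:Z + (L + u)%:Z) = V (e%:Z + L%:Z + u%:Z) by congr V; position.
  have h6 : V (e%:Z + 1) <= V (e%:Z - v%:Z + L%:Z) by apply: V_mono; position.
  have h7 : V (e%:Z - v%:Z - L%:Z + 1) <= V (e%:Z - u%:Z - (L + u)%:Z + 1).
    by apply: V_mono; position.
  have h8 : V (e%:Z - (L + u)%:Z + 1) <= V (e%:Z - L%:Z + 1) by apply: V_mono; position.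
  rewrite h4 in h1; rewrite h5 in h2; rewrite /g in g_small g_ge0 lL; rewrite -/H in h3; lra.
have few : V (e%:Z + 1) - V (e%:Z - u%:Z) <= H * (2%:R / 5%:R).
  have [Nu|uN] := leqP N u.
    have h1 := ball_ge Be' Nu; have h2 := ball_le Be Nu; have h3 := single _ Bu.
    have h4 : V (e%:Z + 1) <= V (e%:Z + u%:Z) by apply: V_mono; position.
    have h5 : V (e%:Z - u%:Z + 1) <= V (e%:Z - u%:Z + 1) by [].
    have h6 : V (e%:Z + 1) <= V (e%:Z + L%:Z - u%:Z + 1) by apply: V_mono; position.
    rewrite /g in g_small; lra.
  have h1 := ball_le Be (leqnn N).
  have h3 : V (e%:Z + 1) <= V (e%:Z + N%:Z) by apply: V_mono; position.
  have h4 : V (e%:Z - N%:Z + 1) <= V (e%:Z - u%:Z) by apply: V_mono; position.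
  lra.
lra.
Qed.
End homogeneous.

(** * Orbits and symmetric sums *)

(** The induction along which identities between functions on the integers
reduce to their increments. *)
Lemma int_step_ind (P : int -> Prop) : P 0 -> (forall i, P i <-> P (i + 1)) ->
  forall i, P i.
Proof.
move=> P0 PS; elim/int_ind => [//|n IH|n IH].
  by rewrite -addn1 PoszD; apply: (PS _).1.
by apply: (PS _).2; have -> : - n.+1%:Z + 1 = - n%:Z by lia.
Qed.

Section orbit.
Context {X : Type} {R : realType}.
Variables (T S : X -> X).
Hypotheses (TK : cancel T S) (SK : cancel S T).

Lemma iterzS (i : int) x : iterz T S (i + 1) x = T (iterz T S i x).
Proof.
case: i => [n|[|n]]; first by rewrite -PoszD addn1.
  by rewrite /= SK.
have -> : Negz n.+1 + 1 = Negz n by lia.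
by rewrite /= SK.
Qed.

Lemma iterzD (i j : int) x : iterz T S i (iterz T S j x) = iterz T S (j + i) x.
Proof.
elim/int_step_ind: i => [|i]; first by rewrite addr0.
rewrite addrA !iterzS; split => [-> //|/(congr1 S)]; by rewrite !TK.
Qed.

Lemma iter_iterz n x : iter n T x = iterz T S n x. Proof. by []. Qed.

Lemma iterS_iterz n x : iter n S x = iterz T S (- n%:Z) x.
Proof. by case: n => [|n] //; rewrite -NegzE. Qed.

Variable g : X -> R.

(** The primitive of [k |-> g (T^k x)] that vanishes at 0: masses of intervals
of the orbit are its differences, with no case distinction on signs. *)
Definition orbit_mass (x : X) (i : int) : R :=
  match i with
  | Posz n => \sum_(k < n) g (iter k T x)
  | Negz n => - \sum_(k < n.+1) g (iter k.+1 S x)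
  end.

Lemma orbit_massS x i : orbit_mass x (i + 1) = orbit_mass x i + g (iterz T S i x).
Proof.
case: i => [n|[|n]].
- by rewrite -PoszD addn1 /= big_ord_recr.
- by rewrite /= big_ord0 big_ord1 addNr.
- have -> : Negz n.+1 + 1 = Negz n by lia.
  by rewrite /= [in RHS]big_ord_recr opprD addrNK.
Qed.

Lemma orbit_mass_shift x (c i : int) :
  orbit_mass (iterz T S c x) i = orbit_mass x (c + i) - orbit_mass x c.
Proof.
elim/int_step_ind: i => [|i]; first by rewrite addr0 subrr /= big_ord0.
rewrite addrA !orbit_massS iterzD; split => [->|H]; first by ring.
by apply: (@addIr _ (g (iterz T S (c + i) x))); rewrite H; ring.
Qed.

Definition ball_sum (n : nat) (x : X) : R :=
  \sum_(k < n) g (iter k T x) + \sum_(k < n.-1) g (iter k.+1 S x).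

Lemma ball_sumE (r : nat) x (c : int) : (0 < r)%N ->
  ball_sum r (iterz T S c x) =
  orbit_mass x (c + r%:Z) - orbit_mass x (c - r%:Z + 1).
Proof.
move=> r0; transitivity (orbit_mass (iterz T S c x) r%:Z -
    orbit_mass (iterz T S c x) (1 - r%:Z)).
  case: r r0 => [//|[|n]] _.
    by rewrite /ball_sum /= !big_ord0 subr0 addr0.
  have -> : 1 - n.+2%:Z = Negz n by lia.
  by rewrite /ball_sum /= opprK.
have E : c + (1 - r%:Z) = c - r%:Z + 1 by lia.
by rewrite !orbit_mass_shift E; ring.
Qed.

Lemma ball_sumE0 (r : nat) x : (0 < r)%N ->
  ball_sum r x = orbit_mass x r%:Z - orbit_mass x (- r%:Z + 1).
Proof. by move=> r0; have := ball_sumE x 0 r0; rewrite !add0r. Qed.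

Lemma birkhoff_symE n x : birkhoff_sym T S g n x = ball_sum n x.
Proof.
pose r := [seq Posz k | k <- iota 0 n] ++ [seq Negz k | k <- iota 0 n.-1].
have ur : uniq r.
  rewrite cat_uniq !map_inj_uniq ?iota_uniq ?andbT; try by move=> ? ? [].
  by apply/hasPn => _ /mapP[k _ ->]; apply/negP => /mapP[].
rewrite /birkhoff_sym; have -> : [set k : int | `|k| < n%:Z] = [set` r].
  apply/seteqP; split => [[k|k]|k] /=.
  - by move=> kn; rewrite mem_cat map_f ?orbT // mem_iota; lia.
  - by move=> kn; rewrite mem_cat orbC map_f ?orbT // mem_iota; lia.
  - by rewrite mem_cat => /orP[] /mapP[j] + ->; rewrite mem_iota; lia.
rewrite -fsbig_seq // big_cat !big_map /ball_sum.
rewrite -(big_mkord xpredT (fun k => g (iter k T x))).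
by rewrite -(big_mkord xpredT (fun k => g (iter k.+1 S x))) /index_iota !subn0.
Qed.

Hypothesis g_ge0 : forall x, 0 <= g x.

Lemma orbit_mass_mono x : {homo orbit_mass x : i j / i <= j}.
Proof.
move=> i j ij; have {ij} [n ->] : exists n : nat, j = i + n%:Z.
  by exists `|j - i|%N; lia.
elim: n => [|n IH]; first by rewrite addr0.
have -> : i + n.+1%:Z = i + n%:Z + 1 by lia.
by rewrite orbit_massS (le_trans IH)// lerDl.
Qed.

Lemma ball_sum_ge0 n x : 0 <= ball_sum n x.
Proof. by rewrite addr_ge0 ?sumr_ge0. Qed.

Lemma ball_sumS n x : ball_sum n.+1 x <= ball_sum n x + g (iter n T x) + g (iter n S x).
Proof.
case: n => [|n]; rewrite /ball_sum /=.
  by rewrite big_ord1 !big_ord0 /= !addr0 add0r lerDl.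
by rewrite big_ord_recr [X in _ + X <= _]big_ord_recr /=; lra.
Qed.

Lemma ball_sum_shift_le n x : ball_sum n (T x) <= ball_sum n.+1 x.
Proof.
case: n => [|n]; first by rewrite {1}/ball_sum !big_ord0 add0r ball_sum_ge0.
rewrite -[T x]/(iterz T S 1 x) ball_sumE // ball_sumE0 //.
by apply: lerB; apply: orbit_mass_mono; lia.
Qed.

Lemma ball_sum_shift_ge n x : ball_sum n x <= ball_sum n.+1 (T x).
Proof.
case: n => [|n]; first by rewrite {1}/ball_sum !big_ord0 add0r ball_sum_ge0.
rewrite -[T x]/(iterz T S 1 x) ball_sumE // ball_sumE0 //.
by apply: lerB; apply: orbit_mass_mono; lia.
Qed.

Lemma ball_sum_mono x : {homo ball_sum^~ x : i j / (i <= j)%N >-> i <= j}.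
Proof.
move=> i j ij; case: i ij => [|i] ij.
  by rewrite {1}/ball_sum !big_ord0 add0r ball_sum_ge0.
rewrite !ball_sumE0 //; last by lia.
by apply: lerB; apply: orbit_mass_mono; lia.
Qed.

End orbit.

(** * Weighted measures and the maximal ergodic inequality *)

Section weighting.
Context {d} {X : measurableType d} {R : realType}.
Variables (m : {measure set X -> \bar R}) (f : X -> R).
Variables (mf : measurable_fun setT f) (f_ge0 : forall x, 0 <= f x).

(** The proofs are arguments so that the set function carries its measure
structure canonically. *)
Definition weighted_measure of measurable_fun setT f & (forall x, 0 <= f x) :=
  fun A : set X => (\int[m]_(x in A) (f x)%:E)%E.

Local Notation nu := (weighted_measure mf f_ge0).

Let nu0 : nu set0 = 0%E. Proof. exact: integral_set0. Qed.

Let nu_ge0 A : (0 <= nu A)%E.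
Proof. by apply: integral_ge0 => x _; rewrite lee_fin. Qed.

Let mfE D : measurable_fun D (fun x => (f x)%:E).
Proof. by apply/measurable_EFinP; exact: measurable_funTS. Qed.

Let nu_sigma_additive : semi_sigma_additive nu.
Proof.
move=> F mF tF mUF; rewrite /weighted_measure ge0_integral_bigcup//; last first.
  by move=> x _; rewrite lee_fin.
by apply: is_cvg_ereal_nneg_natsum => n _; exact: nu_ge0.
Qed.

HB.instance Definition _ := isMeasure.Build _ _ _ nu nu0 nu_ge0 nu_sigma_additive.

Lemma weighted_indic A : measurable A ->
  (\int[m]_x (f x * \1_A x)%:E)%E = nu A.
Proof.
move=> mA; rewrite /weighted_measure [RHS]integral_mkcond; apply: eq_integral => x _.
by rewrite patchE indicE; have [xA|xA] := boolP (x \in A); rewrite ?mulr1 ?mulr0.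
Qed.

End weighting.

Lemma measure_bigcup_le {d} {X : measurableType d} {R : realType}
    (mu : {measure set X -> \bar R}) (F : (set X)^nat) (c : \bar R) :
  (forall n, measurable (F n)) -> nondecreasing_seq F ->
  (forall n, (mu (F n) <= c)%E) -> (mu (\bigcup_n F n) <= c)%E.
Proof.
move=> mF ndF Fc.
have cv := @nondecreasing_cvg_mu _ _ _ mu _ mF (bigcup_measurable (fun k _ => mF k)) ndF.
rewrite -(cvg_lim _ cv)//; apply: lime_le; first by apply/cvg_ex; eexists; exact: cv.
by apply: nearW => n; exact: Fc.
Qed.

Section measurable_sets.
Context {d} {X : measurableType d} {R : realType}.
Implicit Types f g : X -> R.

Lemma measurable_set_lt f g : measurable_fun setT f -> measurable_fun setT g ->
  measurable [set x | f x < g x].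
Proof.
move=> mf mg; have := measurable_fun_ltr mf mg measurableT (Y := [set true]).
by rewrite setTI; apply.
Qed.

Lemma measurable_set_le f g : measurable_fun setT f -> measurable_fun setT g ->
  measurable [set x | f x <= g x].
Proof.
move=> mf mg; have := measurable_fun_ler mf mg measurableT (Y := [set true]).
by rewrite setTI; apply.
Qed.

Lemma measurable_exists (P : nat -> set X) :
  (forall n, measurable (P n)) -> measurable [set x | exists n, P n x].
Proof.
move=> mP; rewrite [X in measurable X](_ : _ = \bigcup_n P n).
  exact: bigcupT_measurable.
by apply/seteqP; split => x [n]; exists n.
Qed.

Lemma measurable_forall (P : nat -> set X) :
  (forall n, measurable (P n)) -> measurable [set x | forall n, P n x].
Proof.
move=> mP; rewrite [X in measurable X](_ : _ = \bigcap_n P n).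
  exact: bigcapT_measurable.
by apply/seteqP; split => x Px n //; exact: Px.
Qed.

Lemma measurable_eventually (P : nat -> set X) :
  (forall n, measurable (P n)) ->
  measurable [set x | exists n0, forall n, (n0 <= n)%N -> P n x].
Proof.
move=> mP; apply: measurable_exists => n0; apply: measurable_forall => n.
case: (n0 <= n)%N; [rewrite [X in measurable X](_ : _ = P n)|
  rewrite [X in measurable X](_ : _ = setT)]; rewrite //.
- by apply/seteqP; split => x // /(_ isT).
- by apply/seteqP; split.
Qed.

End measurable_sets.

Section preserving.
Context {d} {X : measurableType d} {R : realType}.
Variables (m : {measure set X -> \bar R}) (T : X -> X).
Hypothesis Tp : measure_preserving m T.

Lemma integral_preserving (g : X -> \bar R) : measurable_fun setT g ->
  (forall x, (0 <= g x)%E) -> (\int[m]_x g (T x) = \int[m]_x g x)%E.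
Proof.
move=> mg g0; have [mT Tm] := Tp.
rewrite -[LHS]/(\int[m]_(x in T @^-1` setT) (g \o T) x)%E.
rewrite -ge0_integral_pushforward//.
by apply: eq_measure_integral => A mA _; exact: Tm.
Qed.

Lemma measurable_iter n : measurable_fun setT (iter n T).
Proof.
elim: n => [|n IH]; first exact: measurable_id.
by apply: (measurableT_comp _ IH); case: Tp.
Qed.

Lemma measure_preimage_iter n A : measurable A -> m (iter n T @^-1` A) = m A.
Proof.
move=> mA; elim: n => [|n IH] //; rewrite -IH.
rewrite -[RHS](Tp.2 _ _); last first.
  by rewrite -[X in measurable X]setTI; exact: measurable_iter.
by congr (m _); apply/seteqP; split => x /=; rewrite -iterSr.
Qed.

Lemma integral_iter (g : X -> \bar R) n : measurable_fun setT g ->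
  (forall x, (0 <= g x)%E) -> (\int[m]_x g (iter n T x) = \int[m]_x g x)%E.
Proof.
move=> mg g0; elim: n => // n <-.
rewrite -[RHS]integral_preserving//.
  by apply: eq_integral => x _; rewrite iterSr.
exact: measurableT_comp mg (measurable_iter n).
Qed.

Lemma measurable_birkhoff (g : X -> R) n : measurable_fun setT g ->
  measurable_fun setT (fun x => \sum_(k < n) g (iter k T x)).
Proof.
move=> mg; apply: measurable_sum => k.
exact: measurableT_comp mg (measurable_iter k).
Qed.

Section maximal.
Variables g h : X -> R.
Hypotheses (mg : measurable_fun setT g) (mh : measurable_fun setT h).
Hypotheses (g_ge0 : forall x, 0 <= g x) (h_ge0 : forall x, 0 <= h x).
Hypothesis g_fin : (\int[m]_x (g x)%:E < +oo)%E.

(** [max_excess n] is the maximum of 0 and of the first [n] Birkhoff sums of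
[g - h]. The recursion is the identity on which Garsia's proof of the maximal
ergodic theorem rests. *)
Fixpoint max_excess n x : R :=
  if n is k.+1 then Num.max 0 (g x - h x + max_excess k (T x)) else 0.

Let max_excessS n x :
  max_excess n.+1 x = Num.max 0 (g x - h x + max_excess n (T x)).
Proof. by []. Qed.

Let max_excess_ge0 n x : 0 <= max_excess n x.
Proof. by case: n => [|n] //=; rewrite le_max lexx. Qed.

Let max_excess_mono n x : max_excess n x <= max_excess n.+1 x.
Proof.
elim: n x => [|n IH] x; first exact: max_excess_ge0.
rewrite /= ge_max le_max lexx /= le_max; apply/orP; right.
by rewrite lerD2l; exact: IH.
Qed.

Let max_excess_measurable n : measurable_fun setT (max_excess n).
Proof.
elim: n => [|n IH] /=; first exact: measurable_cst.
apply: measurable_maxr; first exact: measurable_cst.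
apply: measurable_funD; first exact: measurable_funB.
by apply: measurableT_comp IH _; case: Tp.
Qed.

Let max_excess_birkhoff n x :
  \sum_(k < n) g (iter k T x) - \sum_(k < n) h (iter k T x) <= max_excess n x.
Proof.
elim: n x => [|n IH] x; first by rewrite !big_ord0 subrr.
rewrite /= le_max; apply/orP; right; rewrite !big_ord_recl.
have := IH (T x).
under eq_bigr do rewrite -iterSr.
under [X in _ - X <= _ -> _]eq_bigr do rewrite -iterSr.
by move=> {}IH; lra.
Qed.

Let max_excess_step n x :
  max_excess n.+1 x + h x * \1_[set y | 0 < max_excess n.+1 y] x
    <= g x + max_excess n (T x).
Proof.
rewrite indicE; have [xp|xn] := boolP (x \in _).
  move: xp; rewrite inE /= lt_max ltxx /= => xp; rewrite mulr1.
  by rewrite /= max_r; [lra|exact: ltW].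
have -> : max_excess n.+1 x = 0.
  apply/eqP; rewrite eq_le max_excess_ge0 andbT leNgt.
  by apply: contra xn => xp; rewrite inE.
by rewrite mulr0 addr0 addr_ge0.
Qed.

Let max_excess_fin n : (\int[m]_x (max_excess n x)%:E < +oo)%E.
Proof.
elim: n => [|n IH]; first by rewrite integral0 ltry.
apply: (@le_lt_trans _ _ (\int[m]_x ((g x)%:E + (max_excess n (T x))%:E))%E).
  apply: ge0_le_integral => //.
  - by move=> x _; rewrite lee_fin.
  - exact/measurable_EFinP.
  - by apply: emeasurable_funD; apply/measurable_EFinP => //;
      apply: measurableT_comp; [|case: Tp].
  - move=> x _; rewrite -EFinD lee_fin max_excessS ge_max addr_ge0 //=.
    by rewrite lerD2r gerBl.
rewrite ge0_integralD //; first last.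
- by apply/measurable_EFinP; apply: measurableT_comp; [|case: Tp].
- by move=> x _; rewrite lee_fin.
- exact/measurable_EFinP.
- by move=> x _; rewrite lee_fin.
rewrite (integral_preserving (g := fun x => (max_excess n x)%:E)) //.
- exact: lte_add_pinfty.
- exact/measurable_EFinP.
- by move=> x; rewrite lee_fin.
Qed.

Let pos_set n := [set x | 0 < max_excess n x].

Let pos_set_measurable n : measurable (pos_set n).
Proof.
by apply: measurable_set_lt => //; exact: max_excess_measurable.
Qed.

Let pos_set_le n : (weighted_measure m mh h_ge0 (pos_set n) <= \int[m]_x (g x)%:E)%E.
Proof.
apply: (@le_trans _ _ (weighted_measure m mh h_ge0 (pos_set n.+1))).
  apply: le_measure; rewrite ?inE// => x /= /lt_le_trans; apply; exact: max_excess_mono.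
have fin := max_excess_fin n.+1.
have fin' : (\int[m]_x (max_excess n.+1 x)%:E)%E \is a fin_num.
  by rewrite ge0_fin_numE // integral_ge0 // => x _; rewrite lee_fin.
have mM k : measurable_fun setT (fun x => (max_excess k x)%:E).
  exact/measurable_EFinP.
have mMT k : measurable_fun setT (fun x => (max_excess k (T x))%:E).
  by apply/measurable_EFinP; apply: measurableT_comp; [|case: Tp].
have mind : measurable_fun setT (fun x => (h x * \1_(pos_set n.+1) x)%:E).
  by apply/measurable_EFinP; apply: measurable_funM => //; exact: measurable_indic.
rewrite -(leeD2lE _ _ fin') -weighted_indic //.
rewrite -ge0_integralD //; [|by move=> x _; rewrite lee_fin..|]; last first.
  by move=> x _; rewrite lee_fin mulr_ge0 // indicE.
apply: (@le_trans _ _ (\int[m]_x ((g x)%:E + (max_excess n (T x))%:E))%E).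
  apply: ge0_le_integral => //.
  - by move=> x _; rewrite -EFinD lee_fin addr_ge0 // mulr_ge0 // indicE.
  - exact: emeasurable_funD.
  - by apply: emeasurable_funD => //; exact/measurable_EFinP.
  - by move=> x _; rewrite -!EFinD lee_fin; exact: max_excess_step.
rewrite ge0_integralD //; [|by move=> x _; rewrite lee_fin|exact/measurable_EFinP|
  by move=> x _; rewrite lee_fin].
rewrite (integral_preserving (g := fun x => (max_excess n x)%:E)); last 2 first.
- exact: mM.
- by move=> x; rewrite lee_fin.
rewrite addeC leeD2r //.
apply: ge0_le_integral => //; first by move=> x _; rewrite lee_fin.
by move=> x _; rewrite lee_fin; exact: max_excess_mono.
Qed.

Definition excess_set := [set x | exists n,
  \sum_(k < n) h (iter k T x) < \sum_(k < n) g (iter k T x)].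

Lemma measurable_excess_set : measurable excess_set.
Proof.
apply: measurable_exists => n.
by apply: measurable_set_lt; exact: measurable_birkhoff.
Qed.

(** By [max_excess_step] the function [h] is, on the set where
[max_excess n.+1] is positive, at most
[g + max_excess n \o T - max_excess n.+1], and the last two terms have a
nonpositive contribution since [T] preserves [m] and [max_excess] is
nondecreasing in [n]. *)
Lemma maximal_inequality :
  (weighted_measure m mh h_ge0 excess_set <= \int[m]_x (g x)%:E)%E.
Proof.
have nd : nondecreasing_seq pos_set.
  apply/nondecreasing_seqP => n; rewrite subsetEset => x /= /lt_le_trans; apply.
  exact: max_excess_mono.
apply: le_trans (measure_bigcup_le pos_set_measurable nd pos_set_le).
apply: le_measure; rewrite ?inE.
- exact: measurable_excess_set.
- exact: bigcup_measurable.
- move=> x [n xn]; exists n => //=.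
  by apply: lt_le_trans (max_excess_birkhoff n x); rewrite subr_gt0.
Qed.

End maximal.
End preserving.

(** * The summation over ages *)

(** Here [p k] will be the measure of the points of age [k] and [v k] their
f-mass. *)
Section averaging.
Variables (R : realFieldType) (A p v : nat -> R) (K M w : R) (N : nat).
Hypotheses (K_gt0 : 0 < K) (w_gt0 : 0 < w).
Hypotheses (p_ge0 : forall k, 0 <= p k) (p_le : forall k, p k <= M).
Hypothesis v_ge0 : forall k, 0 <= v k.
Hypothesis p_unbounded : forall C s0, exists2 s, (s0 <= s)%N & C <= \sum_(k < s) p k.
Hypothesis A_ge : forall s, (N <= s)%N -> s%:R * w <= 2%:R * A s * \sum_(k < s) p k.
Hypothesis gap_mass : forall k s, (N <= k)%N -> (k < s)%N ->
  k%:R * A s * p k <= K * s%:R * \sum_(j < s | (j <= k < 3 * j)%N) v j.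
Hypothesis v_tail : forall e, 0 < e ->
  exists J, forall s, \sum_(j < s | (J <= j)%N) v j <= e.

Let harmonic_window (P : pred nat) j s : (0 < j)%N ->
  \sum_(k < s | P k && (j <= k < 3 * j)%N) (k : nat)%:R^-1 <= 2%:R :> R.
Proof.
move=> j0; have jR : 0 < j%:R :> R by rewrite ltr0n.
apply: (@le_trans _ _ (\sum_(j <= k < 3 * j) j%:R^-1)).
  have -> : \sum_(j <= k < 3 * j) j%:R^-1 =
      \sum_(0 <= k < s + 3 * j | (j <= k < 3 * j)%N) j%:R^-1 :> R.
    rewrite (big_nat_widen _ _ (s + 3 * j)) ?leq_addl //.
    by rewrite (big_nat_widenl j 0) //; apply: eq_bigl => k; rewrite andTb andbC.
  rewrite -(big_mkord (fun k => P k && (j <= k < 3 * j)%N) (fun k : nat => k%:R^-1)).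
  rewrite (big_nat_widen _ _ (s + 3 * j)) ?leq_addr //.
  rewrite big_mkcond [leRHS]big_mkcond; apply: ler_sum => k _ /=.
  case: ifPn => [/andP[/andP[_ /andP[jk k3j]] _]|_].
    by rewrite jk k3j lef_pV2 ?posrE ?ler_nat // ltr0n (leq_trans j0).
  by case: ifP; rewrite // invr_ge0 ler0n.
rewrite sumr_const_nat; have -> : (3 * j - j = j * 2)%N by lia.
by rewrite mulrnA -(mulr_natl _^-1 j) mulfV ?gt_eqF.
Qed.

(** Each [v j] is counted for [j <= k < 3 * j] with weight at most [j^-1]. The
weight [k^-1] on the left is what keeps the total count bounded. *)
Lemma log_window (J s : nat) :
  \sum_(k < s | (3 * J < k)%N) (k : nat)%:R^-1 *
      \sum_(j < s | (j <= k < 3 * j)%N) v j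
    <= 2%:R * \sum_(j < s | (J <= j)%N) v j.
Proof.
under eq_bigr do rewrite mulr_sumr big_mkcond.
rewrite exchange_big /= mulr_sumr [leRHS]big_mkcond; apply: ler_sum => j _.
rewrite -big_mkcondr /= -mulr_suml.
case: ifPn => [Jj|]; last first.
  rewrite -ltnNge => jJ; rewrite big_pred0 ?mul0r // => k; apply/negP.
  by move=> /andP[+ /andP[_]]; lia.
have [j0|j0] := posnP (j : nat).
  rewrite big_pred0 ?mul0r ?mulr_ge0 // => k; rewrite j0 muln0 ltn0 /=.
  by rewrite !andbF.
by rewrite ler_wpM2r //; exact: (harmonic_window (fun k => 3 * J < k)%N).
Qed.

(** [A_ge] bounds [A s / s] times the sum of [p] from below and, by
[gap_mass] and [log_window], the tails of the sum of [v] dominate the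
same quantity once the ages below [t] are discarded. *)
Lemma averaging_contradiction : False.
Proof.
have [J vJ] : exists J, forall s, \sum_(j < s | (J <= j)%N) v j <= w / (9%:R * K).
  by apply: v_tail; rewrite divr_gt0 // mulr_gt0.
have [t Jt Nt] : exists2 t, (3 * J < t)%N & (N <= t)%N.
  by exists (maxn (3 * J).+1 N); rewrite ?leq_maxl ?leq_maxr.
have [s st ps] := p_unbounded (2%:R * (t%:R * M) + 1) t.
have Ns := leq_trans Nt st.
have s0 : 0 < s%:R :> R by rewrite ltr0n (leq_trans _ st) // (leq_trans _ Jt).
set B := \sum_(k < s) p k in ps.
have M0 : 0 <= M by apply: le_trans (p_le 0).
have tM0 : 0 <= t%:R * M by rewrite mulr_ge0.
have B0 : 0 < B by lra.
have As0 : 0 < A s.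
  have := A_ge Ns.
  have : 0 < s%:R * w by rewrite mulr_gt0.
  move=> h1 h2; have : 0 < 2%:R * A s * B by exact: lt_le_trans h2.
  by rewrite pmulr_lgt0 // pmulr_rgt0.
have split_sum : B = \sum_(k < s | (k < t)%N) p k + \sum_(k < s | ~~ (k < t)%N) p k.
  by rewrite /B (bigID (fun k : 'I_s => k < t)%N).
have young : \sum_(k < s | (k < t)%N) p k <= t%:R * M.
  rewrite -(big_ord_widen s p) //.
  apply: (@le_trans _ _ (\sum_(k < t) M)); first exact: ler_sum.
  by rewrite sumr_const card_ord mulr_natl.
have old : A s * \sum_(k < s | ~~ (k < t)%N) p k <= K * s%:R * (2%:R * (w / (9%:R * K))).
  apply: (@le_trans _ _ (K * s%:R * \sum_(k < s | (3 * J < k)%N) ((k : nat)%:R^-1 *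
      \sum_(j < s | (j <= k < 3 * j)%N) v j))); last first.
    rewrite ler_pM2l ?mulr_gt0 //; apply: le_trans (log_window J s) _.
    by rewrite ler_pM2l.
  rewrite !mulr_sumr big_mkcond [leRHS]big_mkcond; apply: ler_sum => k _ /=.
  case: ifPn => [|_]; last first.
    case: ifP => // _.
    by rewrite !mulr_ge0 ?invr_ge0 ?sumr_ge0 ?(ltW K_gt0) ?(ltW s0).
  rewrite -leqNgt => tk; have Jk := leq_trans Jt tk; rewrite Jk.
  have k0 : 0 < (k : nat)%:R :> R by rewrite ltr0n (leq_trans _ Jk).
  rewrite mulrCA -(ler_pM2l k0) !mulrA mulfV ?gt_eqF // mul1r.
  by rewrite -[leRHS]mulrA mulrA; apply: gap_mass; [exact: leq_trans tk|exact: ltn_ord].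
have AB : s%:R * w <= 2%:R * A s * B := A_ge Ns.
have : A s * B <= 2%:R * (A s * \sum_(k < s | ~~ (k < t)%N) p k).
  by rewrite mulrCA ler_pM2l //; lra.
have KE : K * s%:R * (2%:R * (w / (9%:R * K))) = s%:R * w * (2%:R / 9%:R).
  by field; rewrite gt_eqF.
have sw : 0 < s%:R * w by rewrite mulr_gt0.
rewrite KE in old; move: old AB sw; rewrite -(mulrA 2%:R).
move: (A s * _) (A s * _) (s%:R * w) => a b c; lra.
Qed.

End averaging.

(** * Ages since the last visit to a set of finite measure *)

Lemma measure_preserving_inverse {d} {X : measurableType d} {R : realType}
    (m : {measure set X -> \bar R}) (T S : X -> X) : cancel T S ->
  measurable_fun setT S -> measure_preserving m T -> measure_preserving m S.
Proof.
move=> TK mS Tp; split => // A mA; rewrite -(Tp.2 (S @^-1` A)).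
  by congr (m _); apply/seteqP; split => x /=; rewrite TK.
by rewrite -[X in measurable X]setTI; exact: mS.
Qed.

Lemma measure_small_tail {d} {X : measurableType d} {R : realType}
    (mu : {measure set X -> \bar R}) (F : (set X)^nat) (e : R) :
  (forall n, measurable (F n)) -> nonincreasing_seq F ->
  (mu (F 0%N) < +oo)%E -> mu (\bigcap_n F n) = 0%E -> 0 < e ->
  exists n, (mu (F n) <= e%:E)%E.
Proof.
move=> mF niF fin F0 e0.
have cv := @nonincreasing_cvg_mu _ _ _ mu _ fin mF (bigcapT_measurable mF) niF.
rewrite F0 in cv; have /fine_cvgP[_ /cvgrPdist_lt/(_ e e0)[n _ /(_ n (leqnn n))]] := cv.
rewrite /= sub0r normrN ger0_norm; last by rewrite fine_ge0.
move=> /ltW h; exists n; rewrite -lee_fin fineK // in h.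
rewrite ge0_fin_numE //; apply: le_lt_trans fin; apply: le_measure; rewrite ?inE //.
by move/subsetPset : (niF _ _ (leq0n n)).
Qed.

Section transport.
Context {d} {X : measurableType d} {R : realType}.
Variables (m : {measure set X -> \bar R}) (T S : X -> X).
Hypotheses (TK : cancel T S) (SK : cancel S T).
Hypotheses (Tp : measure_preserving m T) (Sp : measure_preserving m S).
Hypotheses (T_ergodic : ergodic m T) (m_infinite : m setT = +oo%E).
Variable f : X -> R.
Hypotheses (mf : measurable_fun setT f) (f_ge0 : forall x, 0 <= f x).
Hypothesis f_fin : (\int[m]_x (f x)%:E < +oo)%E.
Local Notation nu := (weighted_measure m mf f_ge0).
Variable D : set X.
Hypotheses (mD : measurable D) (D_fin : (m D < +oo)%E) (D_pos : (0 < nu D)%E).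

(** The points of age [k]: going backwards, they reach [D] after exactly [k]
steps. *)
Definition first_visit k : set X :=
  [set y | D (iter k S y) /\ forall j, (j < k)%N -> ~ D (iter j S y)].

Let mpre n (A : set X) : measurable A -> measurable (iter n S @^-1` A).
Proof. by move=> mA; rewrite -[X in measurable X]setTI; exact: (measurable_iter Sp). Qed.

Lemma measurable_first_visit k : measurable (first_visit k).
Proof.
apply: measurableI; first exact: mpre.
apply: measurable_forall => j; case: (j < k)%N.
  rewrite [X in measurable X](_ : _ = iter j S @^-1` (~` D)).
    by apply: mpre; exact: measurableC.
  by apply/seteqP; split => x // /(_ isT).
by rewrite [X in measurable X](_ : _ = setT) //; apply/seteqP; split.
Qed.

Lemma first_visit_le k : (m (first_visit k) <= m D)%E.
Proof.
rewrite -(measure_preimage_iter Sp k mD); apply: le_measure; rewrite ?inE.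
- exact: measurable_first_visit.
- exact: mpre.
- by move=> x [].
Qed.

Lemma first_visit_trivIset : trivIset setT first_visit.
Proof.
move=> i j _ _ [y [[Di ni] [Dj nj]]]; case: (ltngtP i j) => // [ij|ji].
  by case: (nj _ ij).
by case: (ni _ ji).
Qed.

Definition visited_within s : set X := [set y | exists2 k, (k < s)%N & D (iter k S y)].

Lemma visited_withinE s : visited_within s = \big[setU/set0]_(k < s) first_visit k.
Proof.
rewrite -bigcup_mkord; apply/seteqP; split => y.
  move=> [k ks Dk].
  have ex : exists k, `[< D (iter k S y) >] by exists k; apply/asboolP.
  case: (ex_minnP ex) => i /asboolP Di i_min; exists i => /=.
    by apply: leq_ltn_trans ks; apply: i_min; apply/asboolP.
  by split => // j ji Dj; have := i_min j (introT (asboolP _) Dj); rewrite leqNgt ji.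
by move=> [k /= ks [Dk _]]; exists k.
Qed.

Lemma measurable_visited_within s : measurable (visited_within s).
Proof.
by rewrite visited_withinE; apply: bigsetU_measurable => k _; exact: measurable_first_visit.
Qed.

Lemma measure_visited_within s :
  m (visited_within s) = (\sum_(k < s) m (first_visit k))%E.
Proof.
rewrite visited_withinE measure_bigsetU //; first exact: measurable_first_visit.
exact: sub_trivIset first_visit_trivIset.
Qed.

(** Forward and backward shifts show that otherwise the points whose two-sided
orbit meets [D] have finite measure; by ergodicity these are almost all the
points. *)
Lemma visited_within_unbounded (C : R) s0 :
  exists2 s, (s0 <= s)%N & (C%:E <= m (visited_within s))%E.
Proof.
apply: contrapT => bounded.
have small s : (m (visited_within s) <= C%:E)%E.
  rewrite leNgt; apply/negP => /ltW Cs; apply: bounded.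
  exists (maxn s0 s); first exact: leq_maxl.
  apply: le_trans Cs _; apply: le_measure; rewrite ?inE; try exact: measurable_visited_within.
  by move=> x [k ks Dk]; exists k => //; rewrite (leq_trans ks) // leq_maxr.
pose Y s := iter s T @^-1` visited_within (s + s)%N.
have mY s : measurable (Y s).
  rewrite -[X in measurable X]setTI; apply: (measurable_iter Tp) => //.
  exact: measurable_visited_within.
pose U : set X := [set y | exists i : int, D (iterz T S i y)].
have YE s y : Y s y <-> exists2 k, (k < s + s)%N & D (iterz T S (s%:Z - k%:Z) y).
  by split => -[k ks Dk]; exists k => //; move: Dk;
    rewrite (iterS_iterz T) (iter_iterz T S) iterzD.
have UE : U = \bigcup_s Y s.
  apply/seteqP; split => y.
    move=> [i Di]; pose s := `|i|.+1%N; exists s => //; apply/YE.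
    by exists `|s%:Z - i|%N; [lia|have -> : s%:Z - `|s%:Z - i|%N%:Z = i by lia].
  by move=> [s _ /YE[k _ Dk]]; exists (s%:Z - k%:Z).
have ndY : nondecreasing_seq Y.
  apply/nondecreasing_seqP => s; rewrite subsetEset => y /YE[k ks Dk].
  apply/YE; exists k.+1; first by lia.
  by have -> : s.+1%:Z - k.+1%:Z = s%:Z - k%:Z by lia.
have mU : measurable U by rewrite UE; exact: bigcupT_measurable.
have U_le : (m U <= C%:E)%E.
  rewrite UE; apply: measure_bigcup_le => // s.
  by rewrite (measure_preimage_iter Tp) //; exact: measurable_visited_within.
have TU : T @^-1` U = U.
  apply/seteqP; split => y /= [i Di].
    by exists (1 + i); rewrite -iterzD.
  exists (i - 1); rewrite -[T y]/(iterz T S 1 y) iterzD //.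
  by have -> : 1 + (i - 1) = i by lia.
have [U0|UC0] := T_ergodic mU TU.
  have : nu D = 0%E.
    apply: null_set_integral => //.
      by apply/measurable_EFinP; exact: measurable_funTS.
    apply/eqP; rewrite -measure_le0 -U0; apply: le_measure; rewrite ?inE //.
    by move=> y Dy; exists 0.
  by have := D_pos; move=> + D0; rewrite D0 ltxx.
have : (m setT <= C%:E)%E.
  have : (m (U `|` ~` U) <= m U + m (~` U))%E := measureU2 m mU (measurableC mU).
  by rewrite setUv UC0 adde0 => /le_trans; apply.
by rewrite m_infinite.
Qed.

Let mfA (A : set X) n : measurable A ->
  measurable_fun setT (fun y => (f (iter n S y) * \1_A (iter n S y))%:E).
Proof.
move=> mA; apply/measurable_EFinP.
apply: (measurableT_comp (f := fun y => f y * \1_A y) _ (measurable_iter Sp n)).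
by apply: measurable_funM => //; exact: measurable_indic.
Qed.

Let fA_ge0 (A : set X) x : (0 <= (f x * \1_A x)%:E)%E.
Proof. by rewrite lee_fin mulr_ge0 // indicE. Qed.

Let fA_integral (A : set X) n : measurable A ->
  (\int[m]_y (f (iter n S y) * \1_A (iter n S y))%:E = nu A)%E.
Proof.
move=> mA; rewrite -weighted_indic //.
rewrite (integral_iter Sp n (g := fun y => (f y * \1_A y)%:E)) //.
exact: (mfA 0).
Qed.

Let integral_cst_indic (A : set X) (c : R) : measurable A -> 0 <= c ->
  (\int[m]_y (c * \1_A y)%:E = c%:E * m A)%E.
Proof.
move=> mA c0; rewrite (eq_integral (fun y => c%:E * (\1_A y)%:E)%E) //.
rewrite ge0_integralZl_EFin //.
- by rewrite (integral_indic m measurableT mA) setIT.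
- by apply/measurable_EFinP; exact: measurable_indic.
Qed.

(** Integrate the number of visits to [D], weighted by [f], during [s]
backward steps. *)
Lemma weighted_visited_within s (c : R) : 0 <= c ->
  (forall y, \sum_(k < s) f (iter k S y) * \1_D (iter k S y) <= c) ->
  (s%:R%:E * nu D <= c%:E * m (visited_within s))%E.
Proof.
move=> c0 fc; have mV := measurable_visited_within s.
have -> : (s%:R%:E * nu D = \sum_(k < s) nu D)%E.
  by rewrite mule_natl sumr_const card_ord.
rewrite -integral_cst_indic //.
rewrite (eq_bigr (fun k : 'I_s =>
  (\int[m]_y (f (iter k S y) * \1_D (iter k S y))%:E)%E)); last first.
  by move=> k _; rewrite fA_integral.
rewrite -ge0_integral_sum //; last by move=> k; exact: mfA.
apply: ge0_le_integral => //.
- by move=> y _; apply: sume_ge0 => k _; exact: fA_ge0.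
- by apply: emeasurable_sum => k; exact: mfA.
- by apply/measurable_EFinP; apply: measurable_funM => //; exact: measurable_indic.
move=> y _; rewrite sumEFin lee_fin indicE.
have [_|yV] := boolP (y \in visited_within s); first by rewrite mulr1.
rewrite mulr0 big1 // => k _; rewrite indicE memNset ?mulr0 // => Dk.
by move: yV; rewrite notin_setE; apply; exists k.
Qed.

(** A point of age [k] passed through the ages [j <= k], and [k - j] backward
steps map it to a point of age [j] without changing measures. *)
Lemma gap_transport k s (c : R) : 0 <= c ->
  (forall x, D x -> c <= \sum_(j < s | (j <= k < 3 * j)%N) f (iter j T x)) ->
  (c%:E * m (first_visit k) <=
   \sum_(j < s | (j <= k < 3 * j)%N) nu (first_visit j))%E.
Proof.
move=> c0 fc; have mP := measurable_first_visit.
rewrite -integral_cst_indic //.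
rewrite (eq_bigr (fun j : 'I_s => (\int[m]_y (f (iter (k - j) S y) *
    \1_(first_visit j) (iter (k - j) S y))%:E)%E)); last first.
  by move=> j _; rewrite fA_integral.
rewrite -big_filter -ge0_integral_sum //; last by move=> j; exact: mfA.
apply: ge0_le_integral => //.
- by move=> y _; rewrite lee_fin mulr_ge0 // indicE.
- by apply/measurable_EFinP; apply: measurable_funM => //; exact: measurable_indic.
- by apply: emeasurable_sum => j; exact: mfA.
move=> y _; rewrite big_filter sumEFin lee_fin indicE.
have [|_] := boolP (y \in first_visit k); last first.
  by rewrite mulr0; apply: sumr_ge0 => j _; rewrite mulr_ge0 // indicE.
rewrite inE mulr1 => -[Dk nD]; apply: le_trans (fc _ Dk) _.
apply: ler_sum => j /andP[jk _].
have kj : iter k S y = iter j S (iter (k - j) S y) by rewrite -iterD subnKC.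
rewrite indicE mem_set ?mulr1; last first.
  split; first by rewrite -kj.
  by move=> i ij; rewrite -iterD; apply: nD; lia.
rewrite kj; move: (iter (k - j) S y) => z.
by rewrite (iterS_iterz T S j z) (iter_iterz T S j) iterzD // addNr.
Qed.

Lemma homogeneous_visits_contradiction (A : nat -> R) (K : R) (N : nat) :
  0 < K -> (forall s, (N <= s)%N -> 0 <= A s) ->
  (forall y s, (N <= s)%N ->
    \sum_(k < s) f (iter k S y) * \1_D (iter k S y) <= 2%:R * A s) ->
  (forall x k s, D x -> (N <= k)%N -> (k < s)%N ->
    k%:R * A s <= K * s%:R * \sum_(j < s | (j <= k < 3 * j)%N) f (iter j T x)) ->
  False.
Proof.
move=> K0 A0 ball gap; have mP := measurable_first_visit.
have nu_fin B : measurable B -> nu B \is a fin_num.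
  move=> mB; rewrite ge0_fin_numE //; apply: le_lt_trans f_fin.
  by apply: (@le_measure _ _ _ nu); rewrite ?inE.
have P_fin k : m (first_visit k) \is a fin_num.
  by rewrite ge0_fin_numE //; apply: le_lt_trans (first_visit_le k) D_fin.
have D_fin' : m D \is a fin_num by rewrite ge0_fin_numE.
pose p k := fine (m (first_visit k)); pose v k := fine (nu (first_visit k)).
have pE k : m (first_visit k) = (p k)%:E by rewrite fineK.
have vE k : nu (first_visit k) = (v k)%:E by rewrite fineK ?nu_fin.
have visE s : m (visited_within s) = (\sum_(k < s) p k)%:E.
  by rewrite measure_visited_within -sumEFin; apply: eq_bigr => k _.
apply: (@averaging_contradiction R A p v K (fine (m D)) (fine (nu D)) N) => //.
- by rewrite fine_gt0 // D_pos /= ltey_eq nu_fin.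
- by move=> k; rewrite fine_ge0.
- by move=> k; rewrite -lee_fin -pE fineK //; exact: first_visit_le.
- by move=> k; rewrite fine_ge0.
- move=> C s0; have [s s0s Cs] := visited_within_unbounded C s0.
  by exists s => //; rewrite -lee_fin -visE.
- move=> s Ns; rewrite -lee_fin EFinM fineK ?nu_fin // EFinM -visE.
  by apply: weighted_visited_within => [|y]; rewrite ?mulr_ge0 ?A0 //; exact: ball.
- move=> k s Nk ks; have s0 : 0 < s%:R :> R by rewrite ltr0n; lia.
  have Ks : 0 < K * s%:R by rewrite mulr_gt0.
  have As : 0 <= A s by apply: A0; lia.
  have := @gap_transport k s (k%:R * A s / (K * s%:R)).
  rewrite divr_ge0 ?mulr_ge0 ?(ltW K0) ?(ltW Ks) // => /(_ isT) H.
  have {H} : k%:R * A s / (K * s%:R) * p k <= \sum_(j < s | (j <= k < 3 * j)%N) v j.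
    rewrite -lee_fin EFinM -pE -sumEFin; under eq_bigr do rewrite -vE.
    by apply: H => x Dx; rewrite ler_pdivrMr // [leRHS]mulrC; exact: gap.
  by rewrite mulrAC ler_pdivrMr // [leRHS]mulrC.
- move=> e e0; pose F J := \bigcup_(j >= J) first_visit j.
  have mF J : measurable (F J) by apply: bigcup_measurable => j _.
  have niF : nonincreasing_seq F.
    move=> i j ij; rewrite subsetEset; apply: bigcup_sub => k /= jk.
    by apply: bigcup_sup => /=; exact: leq_trans jk.
  have [] := @measure_small_tail _ _ _ nu F e mF niF _ _ e0.
  + by rewrite ltey_eq nu_fin.
  + rewrite (_ : \bigcap_n F n = set0) ?measure0 //; apply/seteqP; split => // y Fy.
    have [i _ Pi] := Fy 0%N I; have [j /= ij Pj] := Fy i.+1 I.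
    by have := first_visit_trivIset I I (ex_intro _ y (conj Pi Pj)); lia.
  move=> J FJ; exists J => s; rewrite -lee_fin -sumEFin.
  under eq_bigr do rewrite -vE.
  have triv : trivIset setT (fun j : 'I_s => first_visit j).
    move=> i j _ _ ij; apply: val_inj; exact: first_visit_trivIset.
  apply: le_trans FJ; rewrite -(@measure_bigsetU_ord _ _ _ nu s
    (fun j : 'I_s => (J <= j)%N) (fun j => first_visit j)) //.
  apply: le_measure; rewrite ?inE //; first exact: bigsetU_measurable.
  apply: (@big_ind _ (fun B => B `<=` F J)) => [//|B C BF CF|j Jj].
    by rewrite subUset.
  exact: bigcup_sup.
Qed.

End transport.

(** * No system of infinite measure has homogeneous balls *)

Section bad_ratio.
Context {d} {X : measurableType d} {R : realType}.
Variables (m : {measure set X -> \bar R}) (T : X -> X).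
Hypothesis Tp : measure_preserving m T.
Variable f : X -> R.
Hypotheses (mf : measurable_fun setT f) (f_ge0 : forall x, 0 <= f x).
Hypothesis f_fin : (\int[m]_x (f x)%:E < +oo)%E.
Local Notation nu := (weighted_measure m mf f_ge0).

Definition bad_ratio (A : set X) (c : R) : set X :=
  excess_set T (fun x => f x * \1_A x) (fun x => c * f x).

Lemma bad_ratioPn (A : set X) c x n : ~ bad_ratio A c x ->
  \sum_(k < n) f (iter k T x) * \1_A (iter k T x) <= c * \sum_(k < n) f (iter k T x).
Proof.
move=> xN; rewrite mulr_sumr leNgt; apply/negP => h; apply: xN.
by exists n.
Qed.

Lemma measurable_bad_ratio (A : set X) c : measurable A -> measurable (bad_ratio A c).
Proof.
move=> mA; apply: (measurable_excess_set Tp).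
  by apply: measurable_funM => //; exact: measurable_indic.
exact: measurable_funM.
Qed.

Lemma weighted_bad_ratio (A : set X) c : measurable A -> 0 < c ->
  (nu (bad_ratio A c) <= c^-1%:E * nu A)%E.
Proof.
move=> mA c0.
have mg : measurable_fun setT (fun x => f x * \1_A x).
  by apply: measurable_funM => //; exact: measurable_indic.
have mh : measurable_fun setT (fun x => c * f x) by exact: measurable_funM.
have g0 x : 0 <= f x * \1_A x by rewrite mulr_ge0 // indicE.
have h0 x : 0 <= c * f x by rewrite mulr_ge0 // ltW.
have nuE : (\int[m]_x (f x * \1_A x)%:E = nu A)%E by exact: weighted_indic.
have := @maximal_inequality _ _ _ m T Tp _ _ mg mh g0 h0.
rewrite nuE => H; rewrite -lee_pdivrMl ?invr_gt0 // invrK.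
suff -> : (c%:E * nu (bad_ratio A c))%E = weighted_measure m mh h0 (bad_ratio A c).
  apply: H; apply: le_lt_trans f_fin; apply: (@le_measure _ _ _ nu); rewrite ?inE //.
rewrite /weighted_measure -ge0_integralZl_EFin //.
- exact: measurable_bad_ratio.
- by move=> x _; rewrite lee_fin.
- by apply/measurable_EFinP; exact: measurable_funTS.
- exact: ltW.
Qed.

End bad_ratio.

Section orbit_compare.
Context {X : Type} {R : realType} (T S : X -> X).
Hypotheses (TK : cancel T S) (SK : cancel S T).

Lemma orbit_mass_le (g h : X -> R) x (i j : int) : i <= j ->
  (forall k, i <= k < j -> g (iterz T S k x) <= h (iterz T S k x)) ->
  orbit_mass T S g x j - orbit_mass T S g x i <=
  orbit_mass T S h x j - orbit_mass T S h x i.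
Proof.
move=> ij; have {ij} [n ->] : exists n : nat, j = i + n%:Z.
  by exists `|j - i|%N; lia.
elim: n => [|n IH] gh; first by rewrite addr0 !subrr.
have -> : i + n.+1%:Z = i + n%:Z + 1 by lia.
rewrite !orbit_massS //; have := gh (i + n%:Z); have -> : i <= i + n%:Z < i + n.+1%:Z by lia.
move=> /(_ isT) h1; suff /IH : forall k, i <= k < i + n%:Z ->
  g (iterz T S k x) <= h (iterz T S k x) by lra.
by move=> k ik; apply: gh; lia.
Qed.

Lemma orbit_mass_backward (g : X -> R) x (n : nat) :
  orbit_mass T S g x 1 - orbit_mass T S g x (1 - n%:Z) = \sum_(k < n) g (iter k S x).
Proof.
elim: n => [|n IH]; first by rewrite subr0 subrr big_ord0.
rewrite big_ord_recr -IH (iterS_iterz T S n x) /=.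
have -> : 1 - n%:Z = 1 - n.+1%:Z + 1 by lia.
rewrite orbit_massS //; have -> : 1 - n.+1%:Z = - n%:Z by lia.
by ring.
Qed.

End orbit_compare.

Section pointwise.
Context {X : Type} {R : realType} (T S : X -> X).
Hypotheses (TK : cancel T S) (SK : cancel S T).
Variables (f : X -> R) (A : nat -> R) (N : nat) (B : set X).
Hypothesis f_ge0 : forall x, 0 <= f x.
Hypothesis N_gt0 : (0 < N)%N.
Hypothesis B_ball : forall x r, B x -> (N <= r)%N ->
  A r <= ball_sum T S f r x <= 11%:R / 10%:R * A r.

Lemma visits_ball (D : set X) y s : D `<=` B -> (N <= s)%N -> 0 <= A s ->
  \sum_(k < s) f (iter k S y) * \1_D (iter k S y) <= 2%:R * A s.
Proof.
move=> DB Ns As.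
have [[k Dk]|noD] := pselect (exists k : 'I_s, D (iter k S y)); last first.
  rewrite big1 ?mulr_ge0 // => k _; rewrite indicE memNset ?mulr0 // => Dk.
  by apply: noD; exists k.
apply: (@le_trans _ _ (\sum_(k < s) f (iter k S y))).
  by apply: ler_sum => j _; rewrite ler_piMr // indicE lern1 leq_b1.
have s0 : (0 < s)%N by lia.
have /andP[_] := B_ball (DB _ Dk) Ns.
rewrite (iterS_iterz T S) (ball_sumE TK SK) // => ball.
rewrite -(orbit_mass_backward T S).
have mono := orbit_mass_mono T S f_ge0 y.
have h1 : orbit_mass T S f y 1 <= orbit_mass T S f y (- (k : nat)%:Z + s%:Z).
  by apply: mono; have := ltn_ord k; lia.
have h2 : orbit_mass T S f y (- (k : nat)%:Z - s%:Z + 1) <= orbit_mass T S f y (1 - s%:Z).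
  by apply: mono; lia.
lra.
Qed.

Section good_point.
Variable x : X.
Let g y := f y * \1_(~` B) y.
Hypothesis Bx : B x.
Hypothesis fwd : forall n,
  \sum_(k < n) g (iter k T x) <= 100%:R^-1 * \sum_(k < n) f (iter k T x).
Hypothesis bwd : forall n,
  \sum_(k < n) g (iter k S x) <= 100%:R^-1 * \sum_(k < n) f (iter k S x).
Hypothesis recurrent : forall k, exists2 j, (k <= j)%N & B (iter j T x).

Let V := orbit_mass T S f x.
Let C := orbit_mass T S g x.
Let b : pred int := fun i => `[< B (iterz T S i x) >].

Let g_ge0 y : 0 <= g y.
Proof. by rewrite mulr_ge0 // indicE. Qed.
Let V_mono : {homo V : i j / i <= j}.
Proof. exact: orbit_mass_mono. Qed.
Let C_mono : {homo C : i j / i <= j}.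
Proof. exact: orbit_mass_mono. Qed.
Let CV i j : i <= j -> C j - C i <= V j - V i.
Proof.
by move=> ij; apply: orbit_mass_le => // k _; rewrite /g ler_piMr // indicE lern1 leq_b1.
Qed.
Let free i j : i <= j -> (forall k, i <= k < j -> ~~ b k) -> V j - V i <= C j - C i.
Proof.
move=> ij nb; apply: orbit_mass_le => // k /nb /asboolPn nB.
by rewrite /g indicE mem_set // mulr1.
Qed.
Let ball_ge c (r : nat) : b c -> (N <= r)%N -> A r <= V (c + r%:Z) - V (c - r%:Z + 1).
Proof.
move=> /asboolP Bc Nr; have /andP[+ _] := B_ball Bc Nr.
by rewrite ball_sumE //; lia.
Qed.
Let ball_le c (r : nat) : b c -> (N <= r)%N ->
  V (c + r%:Z) - V (c - r%:Z + 1) <= 11%:R / 10%:R * A r.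
Proof.
move=> /asboolP Bc Nr; have /andP[_] := B_ball Bc Nr.
by rewrite ball_sumE //; lia.
Qed.
Let b0 : b 0. Proof. exact/asboolP. Qed.
Let fwd' (n : nat) : C n%:Z - C 0 <= 100%:R^-1 * (V n%:Z - V 0).
Proof. by rewrite /C /V /= !big_ord0 !subr0; exact: fwd. Qed.
Let bwd' (n : nat) : C 1 - C (1 - n%:Z) <= 100%:R^-1 * (V 1 - V (1 - n%:Z)).
Proof. by rewrite /C /V !orbit_mass_backward; exact: bwd. Qed.
Let recur (k : nat) : exists2 j, (k <= j)%N & b j%:Z.
Proof. by have [j kj Bj] := recurrent k; exists j => //; apply/asboolP. Qed.

(** With [p := k %/ 3], [no_gap] gives a mass at least [A p.+1 / 100] to the
interval (p, 3p], and [scale_regular] compares [A p.+1] with [A s]. *)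
Lemma gap_mass_lower N1 k s : (3 * N <= N1)%N ->
  (forall n, (N1 <= 3 * n)%N -> 100%:R * A N <= A n) ->
  (N1 <= k)%N -> (k < s)%N ->
  k%:R * A s <= (12%:R * 100%:R) * s%:R *
    \sum_(j < s | (j <= k < 3 * j)%N) f (iter j T x).
Proof.
move=> N1N bigA N1k ks; pose p := (k %/ 3)%N.
have pk : (3 * p <= k < 3 * p.+1)%N by rewrite /p; lia.
have Np : (N <= p.+1)%N by lia.
have ps : (p.+1 <= s)%N by lia.
have reg : p.+1%:R * A s <= 4%:R * s%:R * A p.+1.
  by apply: (@scale_regular R V C b A N).
have gap : A p.+1 <= 100%:R * (V (3 * p + 1)%:Z - V (p + 1)%:Z).
  by apply: (@no_gap R V C b A N) => //; apply: bigA; lia.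
have massE : V (3 * p + 1)%:Z - V (p + 1)%:Z <=
    \sum_(j < s | (j <= k < 3 * j)%N) f (iter j T x).
  rewrite /V /= -!(big_mkord xpredT (fun j => f (iter j T x))).
  rewrite (big_cat_nat (n := p + 1)) //=; last by lia.
  rewrite addrAC subrr add0r.
  rewrite -(big_mkord (fun j => j <= k < 3 * j)%N (fun j => f (iter j T x))).
  rewrite [leRHS](big_cat_nat (n := p + 1)) //=; last by lia.
  rewrite [X in _ <= _ + X](big_cat_nat (n := 3 * p + 1)) //=; try lia.
  have -> : \sum_(p + 1 <= i < 3 * p + 1 | (i <= k < 3 * i)%N) f (iter i T x) =
      \sum_(p + 1 <= i < 3 * p + 1) f (iter i T x).
    rewrite big_nat_cond [RHS]big_nat_cond; apply: eq_bigl => i; lia.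
  by rewrite addrCA lerDl addr_ge0 // sumr_ge0.
have As : 0 <= A s.
  have := ball_le b0 (leq_trans Np ps).
  have : V (0 - s%:Z + 1) <= V (0 + s%:Z) by apply: V_mono; lia.
  lra.
have kp : k%:R * A s <= 3%:R * (p.+1%:R * A s).
  by rewrite mulrA -natrM ler_wpM2r // ler_nat; lia.
apply: le_trans kp _.
apply: (@le_trans _ _ (12%:R * s%:R * A p.+1)).
  by move: (p.+1%:R * A s) (s%:R * A p.+1) reg (mulrA 4%:R s%:R (A p.+1)) => u v; lra.
rewrite -!mulrA ler_pM2l // mulrCA ler_wpM2l //.
by apply: le_trans gap _; rewrite ler_pM2l.
Qed.

End good_point.
End pointwise.

Section infinite_system.
Context {d} {X : measurableType d} {R : realType}.
Variables (m : {measure set X -> \bar R}) (T S : X -> X).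
Hypotheses (TK : cancel T S) (SK : cancel S T).
Hypotheses (Tp : measure_preserving m T) (Sp : measure_preserving m S).
Hypotheses (T_ergodic : ergodic m T) (m_infinite : m setT = +oo%E).
Hypothesis T_conservative : conservative m T.
Variable f : X -> R.
Hypotheses (mf : measurable_fun setT f) (f_ge0 : forall x, 0 <= f x).
Hypothesis f_fin : (\int[m]_x (f x)%:E < +oo)%E.
Local Notation nu := (weighted_measure m mf f_ge0).
Local Notation ball := (ball_sum T S f).

Lemma weighted_null (A : set X) : measurable A -> m A = 0%E -> nu A = 0%E.
Proof.
move=> mA A0; apply: null_set_integral => //.
by apply/measurable_EFinP; exact: measurable_funTS.
Qed.

Lemma weighted_fin (A : set X) : measurable A -> (nu A < +oo)%E.
Proof.
by move=> mA; apply: le_lt_trans f_fin; apply: (@le_measure _ _ _ nu); rewrite ?inE.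
Qed.

Lemma measurable_ball_sum n : measurable_fun setT (ball n).
Proof.
by apply: measurable_funD; apply: measurable_sum => k;
  apply: (measurableT_comp mf); apply: measurable_iter; eassumption.
Qed.

Lemma ae_iter (U : X -> X) (P : X -> Prop) : measure_preserving m U ->
  {ae m, forall x, P x} -> {ae m, forall x, forall n, P (iter n U x)}.
Proof.
move=> Up [Z [mZ Z0 PZ]]; apply: ae_foralln => n.
exists (iter n U @^-1` Z); split.
- by rewrite -[X in measurable X]setTI; exact: (measurable_iter Up).
- by rewrite (measure_preimage_iter Up).
- by move=> x /= nP; apply: PZ.
Qed.

Lemma ae_inhabited (P : X -> Prop) : {ae m, forall x, P x} -> exists x, P x.
Proof.
move=> [Z [mZ Z0 PZ]]; apply: contrapT => nP.
suff : m setT = 0%E by rewrite m_infinite.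
apply/eqP; rewrite -measure_le0 -Z0; apply: le_measure; rewrite ?inE //.
by move=> x _; apply: PZ => Px; apply: nP; exists x.
Qed.

Lemma weighted_positive : {ae m, forall x, exists n, 0 < ball n x} ->
  (0 < nu setT)%E.
Proof.
move=> pos; rewrite lt_def measure_ge0 andbT; apply/eqP => nu0.
have mfE : measurable_fun setT (fun x => (f x)%:E) by exact/measurable_EFinP.
have : {ae m, forall x, f x = 0}.
  have : (\int[m]_x `|(f x)%:E| = 0)%E.
    rewrite -[RHS]nu0; apply: eq_integral => x _.
    by rewrite abse_EFin ger0_norm.
  move=> /(ae_eq_integral_abs m measurableT mfE); apply: filterS => x /(_ I) [].
  by [].
move=> f0; have fT := ae_iter Tp f0; have fS := ae_iter Sp f0.
have [x [[xT xS] [n]]] : exists x, ((forall n, f (iter n T x) = 0) /\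
    (forall n, f (iter n S x) = 0)) /\ exists n, 0 < ball n x.
  by apply: ae_inhabited; move: fT fS pos; apply: filterS3.
by rewrite /ball_sum !big1 ?addr0 ?ltxx.
Qed.

Definition nonreturning (B : set X) : set X :=
  B `&` [set x | forall n, ~ B (iter n.+1 T x)].

Lemma measurable_preimage_iter n (B : set X) : measurable B ->
  measurable (iter n T @^-1` B).
Proof. by move=> mB; rewrite -[X in measurable X]setTI; exact: (measurable_iter Tp). Qed.

Lemma measurable_nonreturning (B : set X) : measurable B -> measurable (nonreturning B).
Proof.
move=> mB; apply: measurableI => //; apply: measurable_forall => n.
exact: (measurableC (measurable_preimage_iter n.+1 mB)).
Qed.

(** Two preimages of this set under iterates of [T] cannot meet: it is
wandering. *)
Lemma measure_nonreturning (B : set X) : measurable B -> m (nonreturning B) = 0%E.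
Proof.
move=> mB; apply: T_conservative; split; first exact: measurable_nonreturning.
have key i j x : (i < j)%N -> nonreturning B (iter i T x) ->
    nonreturning B (iter j T x) -> False.
  move=> ij [_ /(_ (j - i).-1) nB] [Bj _]; apply: nB.
  by rewrite -iterD; have -> : ((j - i).-1.+1 + i = j)%N by lia.
move=> i j _ _ [x [Wi Wj]]; case: (ltngtP i j) => // ij; exfalso.
  exact: (key i j x).
exact: (key j i x).
Qed.

Definition recurrent_part (B : set X) : set X :=
  B `\` \bigcup_n (iter n T @^-1` nonreturning B).

Lemma measurable_recurrent_part B : measurable B -> measurable (recurrent_part B).
Proof.
move=> mB; apply: measurableD => //; apply: bigcupT_measurable => n.
by apply: measurable_preimage_iter; exact: measurable_nonreturning.
Qed.

Lemma recurrent_partP B x k : recurrent_part B x ->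
  exists2 j, (k <= j)%N & B (iter j T x).
Proof.
move=> [Bx nW]; elim: k => [|k [j kj Bj]]; first by exists 0%N.
apply: contrapT => none; apply: nW; exists j => //; split => // n Bn.
by apply: none; exists (n.+1 + j)%N; [lia|rewrite iterD].
Qed.

Lemma recurrent_part_null B : measurable B -> m (B `\` recurrent_part B) = 0%E.
Proof.
move=> mB; have mW n : measurable (iter n T @^-1` nonreturning B).
  by apply: measurable_preimage_iter; exact: measurable_nonreturning.
apply/eqP; rewrite -measure_le0.
apply: (@le_trans _ _ (m (\bigcup_n (iter n T @^-1` nonreturning B)))).
  apply: le_measure; rewrite ?inE.
  - by apply: measurableD => //; exact: measurable_recurrent_part.
  - exact: bigcupT_measurable.
  - by move=> x [Bx nR]; apply: contrapT => nW; apply: nR.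
rewrite measure_le0; apply/eqP/negligibleP; first exact: bigcupT_measurable.
apply: negligible_bigcup => n; apply/negligibleP => //.
apply: etrans (measure_nonreturning mB).
exact: (measure_preimage_iter Tp n (measurable_nonreturning mB)).
Qed.

(** The sets where [f >= n.+1^-1] have finite measure and exhaust the f-mass. *)
Lemma weighted_finite_subset (A : set X) : measurable A -> (0 < nu A)%E ->
  exists D, [/\ measurable D, D `<=` A, (m D < +oo)%E & (0 < nu D)%E].
Proof.
move=> mA A0; pose E n := A `&` [set x | n.+1%:R^-1 <= f x].
have mE n : measurable (E n).
  by apply: measurableI => //; apply: measurable_set_le.
have [[n nE]|none] := pselect (exists n, 0 < nu (E n))%E.
  exists (E n); split => //; first by move=> x [].
  have n0 : 0 < n.+1%:R :> R by rewrite ltr0n.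
  have : (n.+1%:R^-1%:E * m (E n) <= nu (E n))%E.
    rewrite -integral_cst //; apply: ge0_le_integral => //.
    - by move=> x _; rewrite lee_fin invr_ge0 ltW.
    - by apply/measurable_EFinP; exact: measurable_funTS.
    - by move=> x [_ xn]; rewrite lee_fin.
  rewrite -lee_pdivlMl // => /le_lt_trans; apply.
  have := weighted_fin (mE n); rewrite ltey_eq.
  rewrite (_ : nu (E n) == -oo = false)%E ?orbF; last first.
    by apply/negbTE; rewrite gt_eqF // (lt_trans _ nE) // ltNy0.
  by move=> /fineK <-; rewrite invrK -EFinM ltry.
have cover : nu A = nu ((\bigcup_n E n) `|` (A `&` [set x | f x <= 0])).
  congr (nu _); apply/seteqP; split => x; last by move=> [[n _ []]|[]].
  move=> Ax; have [fx|fx] := leP (f x) 0; first by right.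
  left; exists (Num.truncn (f x)^-1) => //; split => //=.
  by rewrite -[leRHS]invrK lef_pV2 ?posrE ?invr_gt0 // ltW // real_truncnS_gt // num_real.
have ndE : nondecreasing_seq E.
  apply/nondecreasing_seqP => n; rewrite subsetEset => x [Ax nx]; split => //.
  by apply: le_trans nx; rewrite lef_pV2 ?posrE ?ler_nat ?ltr0n.
have mZ : measurable (A `&` [set x | f x <= 0]).
  by apply: measurableI => //; exact: measurable_set_le.
have : (nu A <= 0)%E.
  have h : (nu (\bigcup_n E n `|` (A `&` [set x | (f x <= 0)%R])) <=
     nu (\bigcup_n E n) + nu (A `&` [set x | (f x <= 0)%R]))%E.
    by apply: measureU2 => //; exact: bigcupT_measurable.
  rewrite cover; apply: le_trans h _.
  have -> : nu (A `&` [set x | f x <= 0]) = 0%E.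
    apply: integral0_eq => x [_ /= fx]; congr (_%:E).
    by apply/eqP; rewrite eq_le fx f_ge0.
  rewrite adde0; apply: measure_bigcup_le => // n; rewrite leNgt; apply/negP => nE.
  by apply: none; exists n.
by rewrite leNgt A0.
Qed.

Let measureU2_le (P Q : set X) (p q : R) : measurable P -> measurable Q ->
  (nu P <= p%:E -> nu Q <= q%:E -> nu (P `|` Q) <= (p + q)%:E)%E.
Proof.
move=> mP mQ Pp Qq; have h : (nu (P `|` Q) <= nu P + nu Q)%E by exact: measureU2.
by apply: le_trans h _; rewrite EFinD; exact: leeD.
Qed.

(** [B N] collects the points whose balls are homogeneous from the radius [N]
on. For large [N] the complement of [B N] has little f-mass, so the maximal
inequality for [T] and for [S] leaves a set of positive f-mass, inside
[B N], of points whose orbit is mostly in [B N] at all scales and on both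
sides. *)
Theorem no_homogeneous_balls (A : nat -> R) :
  (forall C, exists n0, forall n, (n0 <= n)%N -> C <= A n) ->
  {ae m, forall x, exists n0, forall n, (n0 <= n)%N ->
    A n <= ball n x <= 11%:R / 10%:R * A n} -> False.
Proof.
move=> Aoo tight.
pose B N := [set x | forall n, (N <= n)%N -> A n <= ball n x <= 11%:R / 10%:R * A n].
have mB N : measurable (B N).
  apply: measurable_forall => n; case: (N <= n)%N; last first.
    by rewrite [X in measurable X](_ : _ = setT) //; apply/seteqP; split.
  rewrite [X in measurable X](_ : _ = [set x | A n <= ball n x] `&`
      [set x | ball n x <= 11%:R / 10%:R * A n]).
    by apply: measurableI; apply: measurable_set_le => //; exact: measurable_ball_sum.
  apply/seteqP; split => x /=; first by move=> /(_ isT)/andP[].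
  by move=> [-> ->].
pose F N := ~` B N.
have mF N : measurable (F N) by exact: measurableC.
have niF : nonincreasing_seq F.
  move=> i j ij; rewrite subsetEset; apply: subsetC => x Bx n jn.
  by apply: Bx; exact: leq_trans jn.
have nuF0 : nu (\bigcap_n F n) = 0%E.
  have mcap := bigcapT_measurable mF.
  apply: weighted_null => //; apply/negligibleP => //.
  apply: negligibleS tight => x Fx [n0 Bx]; exact: (Fx n0 I).
have pos : (0 < nu setT)%E.
  apply: weighted_positive; apply: filterS tight => x [n0 xt].
  have [n1 A1] := Aoo 1; exists (maxn n0 n1).
  have /andP[+ _] := xt _ (leq_maxl n0 n1).
  by apply: lt_le_trans; apply: lt_le_trans (A1 _ (leq_maxr n0 n1)).
pose W := fine (nu setT).
have nuT : nu setT = W%:E by rewrite fineK // ge0_fin_numE // weighted_fin.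
have W0 : 0 < W by rewrite -lte_fin -nuT.
(* W / 300 for the complement of B N, and W / 3 for each of the two sets where
   the maximal inequality loses a factor 100, add up to less than W *)
have [N0 FN0] : exists n, (nu (F n) <= (W / 300%:R)%:E)%E.
  apply: (measure_small_tail mF niF _ nuF0); first exact: weighted_fin.
  by apply: divr_gt0; [exact: W0|rewrite ltr0n].
pose N := N0.+1.
have FN : (nu (F N) <= (W / 300%:R)%:E)%E.
  apply: le_trans FN0; apply: (@le_measure _ _ _ nu); rewrite ?inE //.
  by move/subsetPset : (niF _ _ (leqnSn N0)).
have bad U : measure_preserving m U ->
    (nu (bad_ratio U f (F N) 100%:R^-1) <= (W / 3%:R)%:E)%E.
  move=> Up; have c0 : 0 < 100%:R^-1 :> R by rewrite invr_gt0 ltr0n.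
  apply: le_trans (weighted_bad_ratio Up mf f_ge0 f_fin (mF N) c0) _.
  rewrite lee_pdivrMl //; apply: le_trans FN _.
  by rewrite -EFinM lee_fin; lra.
pose ET := bad_ratio T f (F N) 100%:R^-1; pose ES := bad_ratio S f (F N) 100%:R^-1.
have mET : measurable ET by exact: (measurable_bad_ratio Tp).
have mES : measurable ES by exact: (measurable_bad_ratio Sp).
pose D0 := recurrent_part (B N) `\` (ET `|` ES).
have mrec := measurable_recurrent_part (mB N).
have mD0 : measurable D0 by apply: measurableD => //; exact: measurableU.
have D0pos : (0 < nu D0)%E.
  rewrite ltNge; apply/negP => D00.
  have mBr : measurable (B N `\` recurrent_part (B N)) by exact: measurableD.
  have nuBr : (nu (B N `\` recurrent_part (B N)) <= 0%:E)%E.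
    by rewrite (weighted_null mBr (recurrent_part_null (mB N))).
  have mE : measurable (ET `|` ES) by exact: measurableU.
  have := measureU2_le (measurableU _ _ mD0 mBr) (measurableU _ _ (mF N) mE)
    (measureU2_le mD0 mBr D00 nuBr)
    (measureU2_le (mF N) mE FN (measureU2_le mET mES (bad T Tp) (bad S Sp))).
  rewrite [X in nu X](_ : _ = setT) ?nuT ?lee_fin; first lra.
  apply/seteqP; split => // x _.
  have [Bx|Bx] := pselect (B N x); last by right; left.
  have [Ex|Ex] := pselect ((ET `|` ES) x); first by right; right.
  by left; have [rx|rx] := pselect (recurrent_part (B N) x); [left|right].
have [D [mD DD0 D_fin D_pos]] := weighted_finite_subset mD0 D0pos.
have DB : D `<=` B N by move=> x /DD0[[]].
have [P0 AP0] := Aoo (Num.max 0 (100%:R * A N)).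
have [N1 N1N N1P] : exists2 N1, (3 * N <= N1)%N & (3 * P0 <= N1)%N.
  by exists (maxn (3 * N) (3 * P0)); rewrite ?leq_maxl ?leq_maxr.
have big s : (N1 <= 3 * s)%N -> 0 <= A s /\ 100%:R * A N <= A s.
  move=> sN; have /AP0 : (P0 <= s)%N by rewrite -(leq_pmul2l (ltn0Sn 2)) (leq_trans N1P).
  by rewrite ge_max => /andP[].
have triple s : (N1 <= s)%N -> (N1 <= 3 * s)%N.
  by move/leq_trans; apply; rewrite leq_pmull.
have B_ball x r : B N x -> (N <= r)%N -> A r <= ball r x <= 11%:R / 10%:R * A r.
  by move=> Bx; exact: Bx.
apply: (@homogeneous_visits_contradiction _ _ _ m T S TK SK Tp Sp T_ergodic
  m_infinite f mf f_ge0 f_fin D mD D_fin D_pos A (12%:R * 100%:R) N1).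
- by rewrite mulr_gt0.
- by move=> s /triple/big[].
- move=> y s sN; apply: (@visits_ball X R T S TK SK f A N (B N)) => //.
  + by apply: leq_trans (leq_trans N1N sN); rewrite leq_pmull.
  + by have [] := big s (triple s sN).
- move=> x k s Dx; have [xr xE] := DD0 x Dx.
  apply: (@gap_mass_lower X R T S TK SK f A N (B N)) => //.
  + exact: DB.
  + by move=> n; apply: bad_ratioPn => xET; apply: xE; left.
  + by move=> n; apply: bad_ratioPn => xES; apply: xE; right.
  + by move=> j; exact: recurrent_partP.
  + by move=> n /big[].
Qed.

End infinite_system.

(** * Growth of symmetric sums and invariant sets *)

Section invariant_growth.
Context {d} {X : measurableType d} {R : realType}.
Variables (m : {measure set X -> \bar R}) (T S : X -> X).
Hypotheses (TK : cancel T S) (SK : cancel S T).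
Hypotheses (Tp : measure_preserving m T) (Sp : measure_preserving m S).
Hypotheses (T_ergodic : ergodic m T) (m_infinite : m setT = +oo%E).
Hypothesis T_conservative : conservative m T.
Variable f : X -> R.
Hypotheses (mf : measurable_fun setT f) (f_ge0 : forall x, 0 <= f x).
Hypothesis f_fin : (\int[m]_x (f x)%:E < +oo)%E.
Local Notation nu := (weighted_measure m mf f_ge0).
Local Notation ball := (ball_sum T S f).

(** Factors decreasing to 1, indexed by integers to keep the sets below
measurable. *)
Definition near_one (j : nat) : R := 1 + j.+1%:R^-1.

Definition slow : set X := [set x | forall j, exists n0, forall n, (n0 <= n)%N ->
  ball n.+1 x <= near_one j * ball n x].

(** The factor [near_one j] is a margin, absorbed when a point is replaced by
its image under [T]; without it the set would not be invariant. *)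
Definition pinched (q : R) (a : nat -> R) : set X :=
  [set x | exists j, exists n0, forall n, (n0 <= n)%N ->
    near_one j * (q * a n) <= ball n x /\
    near_one j * ball n x <= 11%:R / 10%:R * (q * a n)].

Let mball n : measurable_fun setT (ball n).
Proof. exact: (measurable_ball_sum Tp Sp). Qed.

Lemma measurable_slow : measurable slow.
Proof.
apply: measurable_forall => j.
apply: (measurable_eventually (P := fun n => [set x | ball n.+1 x <= near_one j * ball n x])).
by move=> n; apply: measurable_set_le => //; exact: measurable_funM.
Qed.

Lemma measurable_pinched q a : measurable (pinched q a).
Proof.
apply: measurable_exists => j.
apply: (measurable_eventually (P := fun n => [set x |
  near_one j * (q * a n) <= ball n x /\
  near_one j * ball n x <= 11%:R / 10%:R * (q * a n)])) => n.
by apply: measurableI; apply: measurable_set_le => //; exact: measurable_funM.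
Qed.

Lemma slow_rate x c : slow x -> 1 < c ->
  exists n0, forall n, (n0 <= n)%N -> ball n.+1 x <= c * ball n x.
Proof.
move=> sx c1; have [n0 xn] := sx (Num.truncn (c - 1)^-1).
exists n0 => n /xn /le_trans; apply.
rewrite ler_wpM2r ?(ball_sum_ge0 _ _ f_ge0) // /near_one -lerBrDl.
rewrite -[leRHS]invrK lef_pV2 ?posrE ?invr_gt0 ?subr_gt0 //.
by rewrite ltW // real_truncnS_gt // num_real.
Qed.

(** The relation between a point and its image, in a symmetric form that
serves both inclusions of an invariance. *)
Definition neighbours (x y : X) := (forall n, ball n x <= ball n.+1 y) /\
  (forall n, ball n y <= ball n.+1 x).

Lemma neighbours_T x : neighbours x (T x).
Proof.
by split=> n; [exact: (ball_sum_shift_ge TK SK f_ge0)|exact: (ball_sum_shift_le TK SK f_ge0)].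
Qed.

Lemma neighboursC x y : neighbours x y -> neighbours y x.
Proof. by case. Qed.

Lemma inv_nat_itv (j : nat) : 0 < (j.+1%:R^-1 : R) <= 1.
Proof. by rewrite invr_gt0 ltr0n /= invf_le1 ?ltr0n // ler1n. Qed.

(** The balls around [x] of radii [n] and [n + 3] enclose those around [y] of
radii [n + 1] and [n + 2]: three steps, for which a quarter of the margin
each is enough. *)
Lemma neighbours_slow x y : neighbours x y -> slow x -> slow y.
Proof.
move=> [xy yx] sx j; have /andP[] := inv_nat_itv j; set e := j.+1%:R^-1 => e0 e1.
have c1 : 1 < 1 + e / 4%:R by lra.
have [n0 xn] := slow_rate sx c1; exists n0.+1 => -[//|n] n0n.
have h1 := xn n n0n; have h2 := xn n.+1 (leqW n0n).
have h3 := xn n.+2 (leqW (leqW n0n)).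
have h4 := yx n.+2; have h5 := xy n; rewrite /near_one -/e.
set c := 1 + e / 4%:R in h1 h2 h3 c1.
have c0 : 0 <= c by lra.
have b0 := ball_sum_ge0 T S f_ge0 n x.
apply: le_trans h4 _; apply: le_trans h3 _.
apply: (@le_trans _ _ (c * (c * (c * ball n x)))).
  by rewrite ler_wpM2l // (le_trans h2) // ler_wpM2l.
rewrite !mulrA; apply: ler_pM => //; first by rewrite !mulr_ge0.
by rewrite /c; nra.
Qed.

Lemma neighbours_pinched q a x y : 0 < q ->
  (exists n0, forall n, (n0 <= n)%N -> 0 <= a n) ->
  neighbours x y -> slow x -> pinched q a x -> pinched q a y.
Proof.
move=> q0 [na a0] [xy yx] sx [j [n0 xn]].
(* half of the margin serves the growth of the balls around x; see cc *)
exists (2 * j + 2)%N.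
have e3 : (2 * j + 2).+1%:R = 2%:R * j.+1%:R + 1 :> R by rewrite -natrM natr1; congr _%:R; lia.
set c := near_one (2 * j + 2).
have j0 : 0 < j.+1%:R :> R by rewrite ltr0n.
have j1 : 1 <= j.+1%:R :> R by rewrite ler1n.
have c1 : 1 < c by rewrite /c /near_one ltrDl invr_gt0 ltr0n.
have cc : c * c <= near_one j.
  rewrite /c /near_one e3; move: j.+1%:R j0 j1 => t t0 t1.
  have t2 : 0 < 2%:R * t + 1 by lra.
  rewrite -(ler_pM2r (mulr_gt0 t2 t2)) -(ler_pM2r t0).
  have -> : (1 + (2%:R * t + 1)^-1) * (1 + (2%:R * t + 1)^-1) *
    ((2%:R * t + 1) * (2%:R * t + 1)) * t = (2%:R * t + 2%:R) ^+ 2 * t.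
    by field; lra.
  have -> : (1 + t^-1) * ((2%:R * t + 1) * (2%:R * t + 1)) * t =
    (t + 1) * (2%:R * t + 1) ^+ 2 by field; lra.
  nra.
have [n1 sn] := slow_rate sx c1.
exists (maxn n0 (maxn n1 na)).+1 => -[//|n].
rewrite ltnS !geq_max => /and3P[n0n n1n nan].
have [l u] := xn n.+1 (leqW n0n).
have s1 := sn n n1n; have s2 := sn n.+1 (leqW n1n).
have an : 0 <= q * a n.+1 by rewrite mulr_ge0 ?a0 ?(ltW q0) // leqW.
have c0 : 0 < c by lra.
split.
  apply: le_trans (xy n); rewrite -(ler_pM2l c0); apply: le_trans s1.
  apply: le_trans l; rewrite (mulrA c c); exact: ler_wpM2r.
apply: le_trans u; apply: (@le_trans _ _ (c * (c * ball n.+1 x))).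
  by rewrite ler_pM2l //; exact: le_trans (yx n.+1) s2.
by rewrite (mulrA c c) ler_wpM2r // (ball_sum_ge0 _ _ f_ge0).
Qed.

Lemma preimage_slow : T @^-1` slow = slow.
Proof.
apply/seteqP; split => x; apply: neighbours_slow; last exact: neighbours_T.
by apply: neighboursC; exact: neighbours_T.
Qed.

Lemma preimage_slow_pinched q a : 0 < q ->
  (exists n0, forall n, (n0 <= n)%N -> 0 <= a n) ->
  T @^-1` (slow `&` pinched q a) = slow `&` pinched q a.
Proof.
move=> q0 a0; apply/seteqP; split => x [sx px]; split.
- by rewrite -preimage_slow.
- by apply: neighbours_pinched px => //; apply: neighboursC; exact: neighbours_T.
- by rewrite -preimage_slow in sx.
- by apply: neighbours_pinched px => //; exact: neighbours_T.
Qed.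

Section divergent.
Hypothesis ball_oo : {ae m, forall x, forall C, exists n0, forall n, (n0 <= n)%N ->
  C <= ball n x}.

Let above (K : nat) : set X := [set x | K%:R < f x].

Let m_above K : measurable (above K).
Proof. exact: measurable_set_lt. Qed.

Let bad j K := bad_ratio T f (above K) (6%:R * j.+1%:R)^-1 `|`
  bad_ratio S f (above K) (6%:R * j.+1%:R)^-1.

Let term_le (U : X -> X) x K c n : ~ bad_ratio U f (above K) c x ->
  f (iter n U x) <= K%:R + c * \sum_(k < n.+1) f (iter k U x).
Proof.
move=> /(bad_ratioPn n.+1) H.
apply: (@le_trans _ _ (K%:R + f (iter n U x) * \1_(above K) (iter n U x))).
  rewrite indicE; have [_|] := boolP (_ \in _).
    by rewrite mulr1 lerDr.
  by rewrite notin_setE /above /= => /negP; rewrite -leNgt mulr0 addr0.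
rewrite lerD2l; apply: le_trans H; rewrite big_ord_recr /= lerDr.
by apply: sumr_ge0 => k _; rewrite mulr_ge0 // indicE.
Qed.

(** The increment of the symmetric sums at time [n] is at most
[f (T^n x) + f (S^n x)]. The values of [f] below [K] are negligible as the sums
diverge, and those above [K] are controlled by the failure of [bad_ratio]. *)
Let slow_of_not_bad x : (forall C, exists n0, forall n, (n0 <= n)%N -> C <= ball n x) ->
  (forall j, exists K, ~ bad j K x) -> slow x.
Proof.
move=> xoo nbad j; have [K nb] := nbad j.
have /andP[] := inv_nat_itv j; set e := j.+1%:R^-1 => e0 e1.
have eta : (6%:R * j.+1%:R)^-1 = e / 6%:R by rewrite invfM mulrC.
have [n0 x0] := xoo (12%:R * K%:R * j.+1%:R); exists n0 => n n0n.
have tT := @term_le T x K _ n (fun h => nb (or_introl h)).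
have tS := @term_le S x K _ n (fun h => nb (or_intror h)).
rewrite eta in tT tS.
have leT : \sum_(k < n.+1) f (iter k T x) <= ball n.+1 x.
  by rewrite /ball_sum lerDl sumr_ge0.
have leS : \sum_(k < n.+1) f (iter k S x) <= ball n.+1 x.
  rewrite /ball_sum /= big_ord_recl [X in _ <= X + _]big_ord_recl /= -addrA lerD2l.
  by rewrite lerDr sumr_ge0.
have ballS := ball_sumS T S f_ge0 n x.
have x1 := x0 _ n0n; have x2 : ball n x <= ball n.+1 x by exact: (ball_sum_mono TK SK f_ge0).
have ej : e * j.+1%:R = 1 by rewrite mulVf // pnatr_eq0.
have K_le : 2%:R * K%:R <= e / 6%:R * ball n.+1 x.
  have : e / 6%:R * (12%:R * K%:R * j.+1%:R) <= e / 6%:R * ball n.+1 x.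
    by rewrite ler_pM2l ?divr_gt0 //; exact: le_trans x1 x2.
  have -> : e / 6%:R * (12%:R * K%:R * j.+1%:R) = 2%:R * K%:R * (e * j.+1%:R).
    by move: (e) (K%:R) (j.+1%:R) => u v w; field.
  by rewrite ej mulr1.
have eT := ler_wpM2l (ltW (divr_gt0 e0 (ltr0n R 6))) leT.
have eS := ler_wpM2l (ltW (divr_gt0 e0 (ltr0n R 6))) leS.
rewrite /near_one -/e.
set b := ball n.+1 x in K_le leT leS ballS eT eS *.
have b0 : 0 <= b by exact: ball_sum_ge0.
have h : b <= ball n x + 3%:R * (e / 6%:R * b) by lra.
have h2 : (1 + e) * b <= (1 + e) * (ball n x + 3%:R * (e / 6%:R * b)).
  by rewrite ler_wpM2l //; lra.
have h3 : 0 <= e * (1 - e) * b / 2%:R.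
  by rewrite divr_ge0 // !mulr_ge0 ?subr_ge0 // ltW.
rewrite -subr_ge0 in h2; rewrite -subr_ge0; apply: le_trans (addr_ge0 h2 h3) _.
rewrite le_eqVlt; apply/orP; left; apply/eqP.
by move: (e) (b) (ball n x) => u v w; field.
Qed.

(** The points outside [slow] form an invariant set, which has no f-mass: by
[weighted_bad_ratio] the f-mass of [bad j K] tends to 0 with that of the set
where [f > K]. *)
Lemma measure_slowC : m (~` slow) = 0%E.
Proof.
have mZ : measurable (~` slow) by apply: measurableC; exact: measurable_slow.
have TZ : T @^-1` (~` slow) = ~` slow by rewrite -preimage_setC preimage_slow.
have [//|Z0] := T_ergodic mZ TZ.
have mbad j K : measurable (bad j K).
  by apply: measurableU; [exact: (measurable_bad_ratio Tp)|exact: (measurable_bad_ratio Sp)].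
have above_small (e : R) : 0 < e -> exists K, (nu (above K) <= e%:E)%E.
  move=> e0; apply: measure_small_tail => //.
  - move=> i j ij; rewrite subsetEset => x /=; apply: le_lt_trans.
    by rewrite ler_nat.
  - exact: weighted_fin.
  rewrite (_ : \bigcap_n above n = set0) ?measure0 //; apply/seteqP; split => // x xa.
  have := xa (Num.truncn (f x)).+1 I; rewrite /above /= ltNge ltW //.
  by rewrite real_truncnS_gt // num_real.
have bad_null j : nu (\bigcap_K bad j K) = 0%E.
  apply/eqP; rewrite -measure_le0; apply/lee_addgt0Pr => e e0; rewrite add0e.
  have c0 : 0 < (6%:R * j.+1%:R)^-1 :> R by rewrite invr_gt0 mulr_gt0 // ltr0n.
  have [K Ke] := above_small (e / 2%:R * (6%:R * j.+1%:R)^-1)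
    (mulr_gt0 (divr_gt0 e0 (ltr0n R 2)) c0).
  have half U : measure_preserving m U ->
      (nu (bad_ratio U f (above K) (6%:R * j.+1%:R)^-1) <= (e / 2%:R)%:E)%E.
    move=> Up; apply: le_trans (weighted_bad_ratio Up mf f_ge0 f_fin (m_above K) c0) _.
    by rewrite lee_pdivrMl // -EFinM mulrC.
  apply: (@le_trans _ _ (nu (bad j K))).
    apply: (@le_measure _ _ _ nu); rewrite ?inE //; first exact: bigcapT_measurable.
    by move=> x; apply.
  have -> : e%:E = (e / 2%:R)%:E + (e / 2%:R)%:E :> \bar R.
    by rewrite -EFinD; congr (_%:E); lra.
  apply: le_trans (leeD (half T Tp) (half S Sp)).
  by apply: measureU2; [exact: (measurable_bad_ratio Tp)|exact: (measurable_bad_ratio Sp)].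
have [Z1 [mZ1 Z10 PZ1]] := ball_oo.
have mcap : measurable (\bigcup_j \bigcap_K bad j K).
  by apply: bigcupT_measurable => j; exact: bigcapT_measurable.
have nuZ : nu (~` slow) = 0%E.
  have cap0 : nu (\bigcup_j \bigcap_K bad j K) = 0%E.
    apply/negligibleP => //; apply: negligible_bigcup => j.
    by apply/negligibleP; [exact: bigcapT_measurable|exact: bad_null].
  have sub : ~` slow `<=` Z1 `|` \bigcup_j \bigcap_K bad j K.
    move=> x nsx; have [|xZ1] := pselect (Z1 x); [by left|right].
    apply: contrapT => nb; apply: nsx; apply: slow_of_not_bad.
      by apply: contrapT => h; apply: xZ1; apply: PZ1.
    move=> j; apply: contrapT => h; apply: nb; exists j => // K _.
    by apply: contrapT => nbK; apply: h; exists K.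
  apply/eqP; rewrite -measure_le0.
  apply: (@le_trans _ _ (nu (Z1 `|` \bigcup_j \bigcap_K bad j K))).
    by apply: (@le_measure _ _ _ nu); rewrite ?inE //; exact: measurableU.
  have h : (nu (Z1 `|` \bigcup_j \bigcap_K bad j K) <=
    nu Z1 + nu (\bigcup_j \bigcap_K bad j K))%E by exact: measureU2.
  by apply: le_trans h _; rewrite cap0 weighted_null // adde0.
have : (0 < nu setT)%E.
  apply: (weighted_positive Tp Sp m_infinite); apply: filterS ball_oo => x /(_ 1)[n0 xn].
  by exists n0; exact: lt_le_trans (xn _ (leqnn _)).
have nuZC : nu (~` ~` slow) = 0%E by apply: weighted_null => //; exact: measurableC.
have h : (nu (~` slow `|` ~` ~` slow) <= nu (~` slow) + nu (~` ~` slow))%E.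
  by apply: measureU2 => //; exact: measurableC.
by rewrite setUv nuZ nuZC adde0 in h; rewrite ltNge h.
Qed.

Lemma pinched_null q a : 0 < q -> (forall C, exists n0, forall n, (n0 <= n)%N -> C <= a n) ->
  m (slow `&` pinched q a) = 0%E.
Proof.
move=> q0 aoo; have mW : measurable (slow `&` pinched q a).
  by apply: measurableI; [exact: measurable_slow|exact: measurable_pinched].
have [//|WC0] := T_ergodic mW (preimage_slow_pinched q0 (aoo 0)).
exfalso; apply: (@no_homogeneous_balls _ _ _ m T S TK SK Tp Sp T_ergodic
  m_infinite T_conservative f mf f_ge0 f_fin (fun n => q * a n)).
  move=> C; have [n0 an] := aoo (C / q); exists n0 => n /an.
  by rewrite ler_pdivrMr // mulrC.
exists (~` (slow `&` pinched q a)); split => //; first exact: measurableC.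
move=> x /= nx wx; apply: nx; move: wx => [_ [j [n0 xn]]].
have [n1 a1] := aoo 0; exists (maxn n0 n1) => n; rewrite geq_max => /andP[n0n n1n].
have [l u] := xn n n0n.
have c1 : 1 <= near_one j by rewrite /near_one lerDl invr_ge0.
have an : 0 <= q * a n by rewrite mulr_ge0 ?a1 ?(ltW q0).
have bn := ball_sum_ge0 T S f_ge0 n x.
apply/andP; split; first by apply: le_trans l; rewrite ler_peMl.
by apply: le_trans u; rewrite ler_peMl.
Qed.

End divergent.
End invariant_growth.

(** * Upper and lower limits, and the theorem *)

Section limits.
Context {R : realType}.
Implicit Types (u : nat -> \bar R) (y : \bar R).

Lemma limn_esup_lt_eventually u y : (limn_esup u < y)%E ->
  exists n0, forall n, (n0 <= n)%N -> (u n < y)%E.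
Proof.
rewrite limn_esup_lim (cvg_lim _ (@cvg_esups_inf _ u)) //.
move=> /ereal_inf_lt[_ [n0 _ <-] lty]; exists n0 => n n0n.
by apply: le_lt_trans lty; apply: ereal_sup_ubound; exists n.
Qed.

Lemma limn_einf_gt_eventually u y : (y < limn_einf u)%E ->
  exists n0, forall n, (n0 <= n)%N -> (y < u n)%E.
Proof.
rewrite limn_einf_lim (cvg_lim _ (@cvg_einfs_sup _ u)) //.
move=> /ereal_sup_gt[_ [n0 _ <-] lty]; exists n0 => n n0n.
by apply: lt_le_trans lty _; apply: ereal_inf_lbound; exists n.
Qed.

(** Keeping [n] abstract avoids computing with the unary numeral 10001. *)
Lemma ratio_ge (n : nat) : (10 <= n)%N -> 10%:R / 11%:R <= n%:R / n.+1%:R :> R.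
Proof.
move=> n10; rewrite ler_pdivrMr // mulrAC ler_pdivlMr ?ltr0n // -!natrM ler_nat.
lia.
Qed.

(** Since 10/11 <= 10001/10002, there is room for a rational number between
[10/11 * L] and [l]. *)
Lemma pinched_of_ratio (u : nat -> R) :
  let l := limn_einf (fun n => (u n)%:E) in
  let L := limn_esup (fun n => (u n)%:E) in
  (0 < l < +oo)%E -> ~ (l / L <= (10001%:R / 10002%:R)%:E)%E ->
  exists q : rat, 0 < ratr q :> R /\ exists j, exists n0, forall n, (n0 <= n)%N ->
    near_one j * ratr q <= u n /\ near_one j * u n <= 11%:R / 10%:R * ratr q.
Proof.
move=> l L /andP[l0 loo] notle.
have lL : (l <= L)%E by exact: limn_einf_sup.
have c0 : 10%:R / 11%:R <= 10001%:R / 10002%:R :> R by exact: (@ratio_ge 10001).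
have lfin : l \is a fin_num by rewrite ge0_fin_numE // ltW.
have [LE|Lfin] := eqVneq L +oo%E.
  exfalso; apply: notle; rewrite LE invey mule0 lee_fin.
  by apply: le_trans c0; rewrite divr_ge0.
have L0 : (0 < L)%E by exact: lt_le_trans lL.
have {}Lfin : L \is a fin_num by rewrite ge0_fin_numE ?ltey // ltW.
pose b := fine L; pose a := fine l.
have LE : L = b%:E by rewrite fineK.
have lE : l = a%:E by rewrite fineK.
have b0 : 0 < b by rewrite -lte_fin -LE.
have ab : 10%:R / 11%:R * b < a.
  move: notle; rewrite LE lE inver gt_eqF // -EFinM lee_fin => /negP.
  rewrite -ltNge ltr_pdivlMr //; apply: le_lt_trans.
  by rewrite ler_pM2r.
have [q] := rat_in_itvoo ab.
rewrite in_itv /= => /andP[bq qa]; exists q.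
have q0 : 0 < ratr q :> R by apply: lt_trans bq; rewrite mulr_gt0.
split => //.
pose s : R := ratr q; rewrite -/s in bq qa q0 *.
(* the midpoints of (s, a) and (b, 11/10 s) leave a margin *)
have [n1 low] : exists n0, forall n, (n0 <= n)%N -> (((s + a) / 2%:R)%:E < (u n)%:E)%E.
  by apply: limn_einf_gt_eventually; rewrite -/l lE lte_fin; lra.
have [n2 up] : exists n0, forall n, (n0 <= n)%N ->
    ((u n)%:E < ((b + 11%:R / 10%:R * s) / 2%:R)%:E)%E.
  by apply: limn_esup_lt_eventually; rewrite -/L LE lte_fin; lra.
pose M := (s + a) / 2%:R; pose M' := (b + 11%:R / 10%:R * s) / 2%:R.
pose e := Num.min (M / s - 1) (11%:R / 10%:R * s / M' - 1).
have M'0 : 0 < M' by rewrite /M'; lra.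
have e0 : 0 < e.
  have sM : s < M by rewrite /M; lra.
  have M's : M' < 11%:R / 10%:R * s by rewrite /M'; lra.
  rewrite lt_min !subr_gt0; apply/andP; split.
    by rewrite -[ltLHS](mulfV (lt0r_neq0 q0)) ltr_pM2r // invr_gt0.
  by rewrite -[ltLHS](mulfV (lt0r_neq0 M'0)) ltr_pM2r // invr_gt0.
pose j := Num.truncn e^-1.
have je : near_one j <= 1 + e.
  rewrite /near_one lerD2l -[leRHS]invrK lef_pV2 ?posrE ?invr_gt0 //.
  by rewrite ltW // real_truncnS_gt // num_real.
exists j, (maxn n1 n2) => n; rewrite geq_max => /andP[/low + /up].
rewrite !lte_fin -/M -/M' => lo hi.
have je0 : 0 < (near_one j : R) by rewrite /near_one addr_gt0 // invr_gt0 ltr0n.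
split.
  apply: ltW; apply: le_lt_trans lo; rewrite -ler_pdivlMr //.
  by apply: le_trans je _; rewrite -lerBrDl ge_min lexx.
apply: (@le_trans _ _ (near_one j * M')); first by rewrite ler_pM2l // ltW.
rewrite -ler_pdivlMr //; apply: le_trans je _.
by rewrite -lerBrDl ge_min lexx orbT.
Qed.

End limits.

Theorem theorem1 (R : realType) (d : measure_display) (X : measurableType d)
    (m : {sigma_finite_measure set X -> \bar R})
    (T S : X -> X) (f : X -> R) (a : nat -> R)
    (X_standard : standard_borel R X)
    (m_infinite : m [set: X] = +oo%E)
    (TK : cancel T S) (SK : cancel S T)
    (S_measurable : measurable_fun [set: X] S)
    (T_preserving : measure_preserving m T)
    (T_conservative : conservative m T)
    (T_ergodic : ergodic m T)
    (f_ge0 : {ae m, forall x, 0 <= f x})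
    (f_L1 : m.-integrable [set: X] (EFin \o f))
    (a_infty : a n @[n --> \oo] --> +oo)
    (liminf_pos_fin :
       {ae m, forall x, (0 < birkhoff_liminf T S f a x < +oo)%E}) :
  {ae m, forall x,
     (birkhoff_liminf T S f a x / birkhoff_limsup T S f a x
        <= (10001%:R / 10002%:R)%:E)%E}.
Proof.
have Tp := T_preserving; have Sp := measure_preserving_inverse TK S_measurable Tp.
have aoo C : exists n0, forall n, (n0 <= n)%N -> C <= a n.
  by move/cvgryPge : a_infty => /(_ C)[n0 _ an]; exists n0 => n /an.
have mf : measurable_fun setT f.
  by apply/measurable_EFinP; exact: measurable_int f_L1.
pose g x := Num.max 0 (f x).
have mg : measurable_fun setT g by exact: measurable_maxr.
have g_ge0 x : 0 <= g x by rewrite le_max lexx.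
have g_fin : (\int[m]_x (g x)%:E < +oo)%E.
  have /integrableP[_] := f_L1; apply: le_lt_trans; apply: ge0_le_integral => //.
  - by move=> x _; rewrite lee_fin.
  - exact/measurable_EFinP.
  - by apply: measurableT_comp => //; exact/measurable_EFinP.
  - by move=> x _; rewrite abse_EFin lee_fin ge_max normr_ge0 ler_norm.
have fgE : {ae m, forall x n, birkhoff_sym T S f n x = ball_sum T S g n x}.
  have fg : {ae m, forall x, f x = g x}.
    by apply: filterS f_ge0 => x fx; rewrite /g max_r.
  move: (ae_iter Tp fg) (ae_iter Sp fg); apply: filterS2 => x xT xS n.
  by rewrite birkhoff_symE /ball_sum; congr (_ + _); apply: eq_bigr => k _;
    [exact: xT|exact: xS].
have liminf_gt0 : {ae m, forall x, exists q : R, 0 < q /\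
    exists n0, forall n, (n0 <= n)%N -> q * a n <= ball_sum T S g n x}.
  move: liminf_pos_fin fgE; apply: filterS2 => x /andP[l0 loo] xE.
  have [q /andP[q0 ql]] : exists q : R, (0 < q) && (q%:E < birkhoff_liminf T S f a x)%E.
    move: l0 loo; case: (birkhoff_liminf _ _ _ _ _) => [r|//|//] r0 _.
    by exists (r / 2%:R); move: r0; rewrite !lte_fin => r0; apply/andP; split; lra.
  have [n0 xn] := limn_einf_gt_eventually ql.
  have [n1 an] := aoo 1; exists q; split => //; exists (maxn n0 n1) => n.
  rewrite geq_max => /andP[n0n n1n]; have an0 : 0 < a n by apply: lt_le_trans (an n n1n).
  by rewrite -ler_pdivlMr // -xE -lee_fin ltW // xn.
have ball_oo : {ae m, forall x, forall C, exists n0, forall n, (n0 <= n)%N ->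
    C <= ball_sum T S g n x}.
  apply: filterS liminf_gt0 => x [q [q0 [n0 xn]]] C; have [n1 an] := aoo (C / q).
  exists (maxn n0 n1) => n; rewrite geq_max => /andP[n0n n1n].
  by apply: le_trans (xn n n0n); rewrite mulrC -ler_pdivrMr //; exact: an.
have slow_ae : {ae m, forall x, slow T S g x}.
  exists (~` slow T S g); split => //.
  - by apply: measurableC; exact: (measurable_slow Tp Sp).
  - exact: (measure_slowC TK SK Tp Sp T_ergodic m_infinite mg g_ge0 g_fin ball_oo).
have not_pinched : {ae m, forall x, forall q : rat, 0 < ratr q :> R ->
    ~ pinched T S g (ratr q) a x}.
  have nul (q : rat) : {ae m, forall x, 0 < ratr q :> R -> slow T S g x ->
      ~ pinched T S g (ratr q) a x}.
    have [q0|q0] := ltP 0 (ratr q : R); last by apply: aeW.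
    exists (slow T S g `&` pinched T S g (ratr q) a); split.
    - by apply: measurableI;
        [exact: (measurable_slow Tp Sp)|exact: (measurable_pinched Tp Sp)].
    - exact: (pinched_null TK SK Tp Sp T_ergodic m_infinite T_conservative mg g_ge0 g_fin).
    - by move=> x /= nx; apply: contrapT => h; apply: nx => _ sx px; apply: h.
  have all := ae_foralln (fun k => nul (odflt 0 (unpickle k))).
  apply: (@filterS2 _ _ _ _ _ _ _ slow_ae all) => x sx nx q q0.
  have := nx (pickle q).
  by rewrite pickleK; apply.
move: liminf_pos_fin fgE not_pinched; apply: filterS3 => x lx xE nx.
apply: contrapT => notle; have [q [q0 [j [n0 xn]]]] := pinched_of_ratio lx notle.
have [n1 an] := aoo 1; apply: (nx q q0); exists j, (maxn n0 n1) => n.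
rewrite geq_max => /andP[n0n n1n]; have an0 : 0 < a n by apply: lt_le_trans (an n n1n).
have [l u] := xn n n0n; rewrite xE in l u; split.
  by rewrite mulrA -ler_pdivlMr.
by rewrite [leRHS]mulrA -ler_pdivrMr // -[leLHS]mulrA.
Qed.
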